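(* For two different non-integers $\beta_1,\beta_2>1$, the Rényi–Parry measures coincide, i.e. $\nu_{\beta_1}=\nu_{\beta_2}$, if and only if $\beta_1$ is the root of the equation $x^2-qx-p=0$, where $p,q\in\mathbb{N}$ with $p\le q$, and $\beta_2=\beta_1+1$. In particular, if $\nu_{\beta_1}=\nu_{\beta_2}$, then $\beta_1$ and $\beta_2$ are two Pisot numbers of degree $2$.
   Context: $\mathbb{N}=\{1,2,3,\dots\}$. For real $\beta>1$, the $\beta$-transformation $T_\beta:[0,1)\to[0,1)$ is $T_\beta(x)=\beta x \pmod 1$, i.e. $T_\beta(x)=\beta x-\lfloor \beta x\rfloor$. The Rényi–Parry measure $\nu_\beta$ is the unique $T_\beta$-invariant Borel probability measure on $[0,1)$ equivalent to Lebesgue measure (existence and uniqueness for non-integer $\beta$ are due to Rényi). By a theorem of Parry, its density with respect to Lebesgue measure is $\widetilde h_\beta(x)=\frac{1}{K_\beta}\sum_{n\ge 0,\ T_\beta^n(1)>x}\beta^{-n}$ for $x\in[0,1)$, where $T_\beta^0(1):=1$, $T_\beta^1(1):=\beta-\lfloor\beta\rfloor$, $T_\beta^n(1):=T_\beta(T_\beta^{n-1}(1))$ for $n\ge 2$, and $K_\beta=\sum_{n=0}^\infty T_\beta^n(1)\beta^{-n}$. A Pisot number is an algebraic integer greater than $1$ all of whose other algebraic conjugates have modulus strictly less than $1$; its degree is the degree of its minimal polynomial.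
   Formalization: The pair is treated as unordered: the condition is required of (β1, β2) or of (β2, β1), because as literally stated the ''only if'' fails when β1 = β2 + 1 (e.g. β2 the golden ratio); for β1 < β2 it is exactly the stated condition. *)

(* Defs.v *)
From HB Require Import structures.
From mathcomp Require Import all_boot all_order all_algebra.
From mathcomp Require Import all_classical all_reals all_analysis.
From mathcomp Require Import complex.

Set Implicit Arguments.
Unset Strict Implicit.
Unset Printing Implicit Defensive.

Import Order.TTheory GRing.Theory Num.Theory.
Import numFieldNormedType.Exports.

Local Open Scope classical_set_scope.
Local Open Scope ring_scope.

Definition beta_transform {R : realType} (beta x : R) : R :=
  beta * x - (Num.floor (beta * x))%:~R.

(* Borel probability measures on [0, 1[ are represented by Borel probability
   measures on R that give mass 1 to [0, 1[. The two null_dominates clauses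
   say that nu and Lebesgue measure on [0, 1[ have the same null sets. *)
Definition is_Renyi_Parry {R : realType} (beta : R)
    (nu : probability (measurableTypeR R) R) : Prop :=
  let lambda := mrestr lebesgue_measure (measurable_itv `[(0 : R), 1[) in
  [/\ nu `[(0 : R), 1[%classic = 1%E,
      forall A : set (measurableTypeR R), measurable A -> A `<=` `[0, 1[%classic ->
        nu (`[0, 1[%classic `&` beta_transform beta @^-1` A) = nu A,
      nu `<< lambda & lambda `<< nu].

(* Equality is required on Borel sets only: the value of the underlying
   function on a non-measurable set is irrelevant. *)
Definition measures_coincide {R : realType}
    (nu1 nu2 : probability (measurableTypeR R) R) : Prop :=
  forall A : set (measurableTypeR R), measurable A -> nu1 A = nu2 A.

(* p is the monic generator of the ideal of rational polynomials vanishing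
   at x; no such p exists when x is transcendental. *)
Definition is_minpoly {R : realType} (x : R) (p : {poly rat}) : Prop :=
  p \is monic /\
  forall q : {poly rat}, root (map_poly ratr q) x = (p %| q).

Definition has_degree {R : realType} (x : R) (n : nat) : Prop :=
  exists2 p : {poly rat}, is_minpoly x p & size p = n.+1.

Definition is_Pisot {R : realType} (x : R) : Prop :=
  [/\ 1 < x,
      integralOver (intr : int -> R) x &
      exists2 p : {poly rat}, is_minpoly x p &
        forall z : R[i], root (map_poly ratr p) z -> z != (x%:C)%C ->
          `|z| < 1].

Definition quadratic_pair {R : realType} (b1 b2 : R) : Prop :=
  (exists p q : nat, [/\ (0 < p)%N, (0 < q)%N, (p <= q)%N &
     b1 ^+ 2 - q%:R * b1 - p%:R = 0]) /\
  b2 = b1 + 1.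

(* Main.v *)
Require Import Defs.
From HB Require Import structures.
From mathcomp Require Import all_boot all_order all_algebra.
From mathcomp Require Import all_classical all_reals all_analysis.
From mathcomp Require Import measurable_realfun complex.
From mathcomp Require Import ring lra zify.

Set Implicit Arguments.
Unset Strict Implicit.
Unset Printing Implicit Defensive.

Import Order.TTheory GRing.Theory Num.Theory.
Import numFieldNormedType.Exports.
Local Open Scope classical_set_scope.
Local Open Scope ring_scope.

(* Write T for the beta-transformation, r_n = T^n 1 and l for Lebesgue measure.
   For E measurable and 0 <= r <= 1, cutting [0, r[ into the branches of T gives
     b l(T^-1 E /\ [0, r[) = floor(b r) l(E) + l(E /\ [0, T r[).        ( * )
   If E is T-invariant, then psi a = l(E /\ [0, a[) - a l(E) satisfies
   psi a = psi (T a) / b by ( * ), so psi = 0, and E is null or conull.  Hence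
   the invariant probability equivalent to l is unique.  By ( * ) again, and
   sum floor(b r_n) b^-(n+1) = 1, it is proportional to
   E |-> sum_n b^-n l(E /\ [0, r_n[).  Second differences of its distribution
   function recover the atoms J(y) = sum_(n | r_n = y) b^-n for 0 < y <= 1
   (J(1) = 1 fixes the factor), and the slope at 0 gives
   H = sum_(n | r_n > 0) b^-n.  So if the measures for b and c coincide, J and H
   coincide.  If neither orbit reaches 0 then H = b / (b - 1) = c / (c - 1); if
   both do, 1/b and 1/c are both the largest atom below 1.  Otherwise one orbit
   is finite and the other is not, and comparing atoms shows that the finite one
   is 1, r_1, 0 and the infinite one 1, r_1, r_1, ... *)

(** * Series in powers of 1/b *)

Lemma norm_bool_le1 (R : realType) (P : bool) : `|P%:R : R| <= 1.
Proof. by rewrite normr_nat lern1 leq_b1. Qed.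

Definition bterm {R : realType} (b : R) (u : nat -> R) : nat -> R :=
  fun n => u n / b ^+ n.

(** [limn] takes a default value on divergent sequences, so the rules below carry convergence or
    boundedness hypotheses. *)
Definition bsum {R : realType} (b : R) (u : nat -> R) : R :=
  limn (series (bterm b u)).

Lemma is_cvg_bterm (R : realType) (b : R) (u : nat -> R) (C : R) :
  1 < b -> (forall n, `|u n| <= C) -> cvgn (series (bterm b u)).
Proof.
move=> b1 uC; have b0 : 0 < b by lra.
apply: normed_cvg.
apply: (@series_le_cvg _ _ (geometric C b^-1)).
- by move=> n; exact: normr_ge0.
- move=> n; rewrite /geometric /= mulr_ge0 ?exprn_ge0 ?invr_ge0 ?(ltW b0)//.
  exact: le_trans (uC 0%N).
- move=> n; rewrite /bterm /= normrM normfV normrX (gtr0_norm b0) /geometric /=.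
  by rewrite exprVn ler_wpM2r// invr_ge0 exprn_ge0// ltW.
- apply: is_cvg_geometric_series; rewrite normfV gtr0_norm//.
  by rewrite invf_lt1.
Qed.

Lemma bsumD (R : realType) (b : R) (u v : nat -> R) :
  cvgn (series (bterm b u)) -> cvgn (series (bterm b v)) ->
  bsum b (fun n => u n + v n) = bsum b u + bsum b v.
Proof.
move=> cu cv; rewrite /bsum -limD//; congr (limn _).
by apply/funext => n; rewrite /series /= fctE -big_split/=;
  apply: eq_bigr => i _; rewrite /bterm mulrDl.
Qed.

Lemma bsumZ (R : realType) (b c : R) (u : nat -> R) :
  cvgn (series (bterm b u)) -> bsum b (fun n => c * u n) = c * bsum b u.
Proof.
move=> cu; apply/cvg_lim => //.
rewrite (_ : series _ = fun n => c * series (bterm b u) n); last first.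
  apply/funext => n; rewrite /series /= mulr_sumr.
  by apply: eq_bigr => i _; rewrite /bterm mulrA.
by apply: cvgM; [exact: cvg_cst|exact: cu].
Qed.

Lemma ler_bsum (R : realType) (b : R) (u v : nat -> R) : 0 < b ->
  cvgn (series (bterm b u)) -> cvgn (series (bterm b v)) ->
  (forall n, u n <= v n) -> bsum b u <= bsum b v.
Proof.
move=> b0 cu cv uv; apply: ler_lim => //; apply: nearW => n.
apply: ler_sum => i _; rewrite /bterm ler_wpM2r ?uv//.
by rewrite invr_ge0 exprn_ge0// ltW.
Qed.

Lemma eq_bsum (R : realType) (b : R) (u v : nat -> R) :
  u =1 v -> bsum b u = bsum b v.
Proof. by move=> uv; congr (bsum b _); exact/funext. Qed.

Lemma bsum_cst0 (R : realType) (b : R) : bsum b (fun=> 0) = 0.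
Proof.
rewrite /bsum (_ : series _ = cst 0) ?lim_cst//; apply/funext => n.
by rewrite /series/= big1// => i _; rewrite /bterm mul0r.
Qed.

Lemma bsum_recl (R : realType) (b : R) (u : nat -> R) (C : R) :
  1 < b -> (forall n, `|u n| <= C) ->
  bsum b u = u 0%N + bsum b (fun n => u n.+1) / b.
Proof.
move=> b1 uC; have b0 : 0 < b by lra.
have cS : cvgn (series (bterm b (fun n => u n.+1))) by exact: is_cvg_bterm b1 _.
have h n : series (bterm b u) n.+1 =
    u 0%N + b^-1 * series (bterm b (fun n => u n.+1)) n.
  rewrite /series /= big_nat_recl// /bterm expr0 divr1 mulr_sumr.
  congr (_ + _); apply: eq_bigr => i _.
  by rewrite exprS invfM mulrCA.
have cvg1 : (fun n => series (bterm b u) n.+1) @ \oo -->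
    u 0%N + b^-1 * bsum b (fun n => u n.+1).
  under eq_fun do rewrite h.
  by apply: cvgD; [exact: cvg_cst|apply: cvgM; [exact: cvg_cst|exact: cS]].
rewrite [_ / b]mulrC; apply/cvg_lim => //.
by rewrite -(cvg_shiftS (series (bterm b u))).
Qed.

Lemma bsum_cst1 (R : realType) (b : R) : 1 < b -> bsum b (fun=> 1) = b / (b - 1).
Proof.
move=> b1; have := @bsum_recl R b (fun=> 1) 1 b1 (fun=> norm_bool_le1 R true).
(* Peeling off the first term gives the fixed-point equation S = 1 + S / b. *)
move=> /= h; have : bsum b (fun=> 1) * b = b + bsum b (fun=> 1).
  by rewrite {1}h; field; lra.
by move=> h2; apply: (mulIf (_ : b - 1 != 0)); [lra | rewrite divfK; lra].
Qed.

Lemma bsum_bound (R : realType) (b : R) (u : nat -> R) : 1 < b ->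
  (forall n, `|u n| <= 1) -> `|bsum b u| <= b / (b - 1).
Proof.
move=> b1 u1; rewrite ler_norml -bsum_cst1//.
have c1 : cvgn (series (bterm b (fun=> 1))).
  by apply: (is_cvg_bterm (C := 1) b1) => ?; rewrite normr1.
have cu := is_cvg_bterm b1 u1.
have cN : cvgn (series (bterm b (fun=> -1))).
  by apply: (is_cvg_bterm (C := 1) b1) => ?; rewrite normrN1.
apply/andP; split; last first.
  by apply: ler_bsum => //; [lra|move=> n; exact: le_trans (ler_norm _) (u1 n)].
have -> : - bsum b (fun=> 1) = bsum b (fun=> -1).
  rewrite -[LHS]mulN1r -(bsumZ (-1) c1).
  by apply: eq_bsum => n; rewrite mulr1.
apply: ler_bsum => //; first lra.
by move=> n; have := u1 n; rewrite ler_norml => /andP[].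
Qed.

(** Each common term peeled off gains a factor 1/b; what remains is bounded by the two full sums. *)
Lemma bsum_close (R : realType) (b : R) (N : nat) (u v : nat -> R) : 1 < b ->
  (forall n, `|u n| <= 1) -> (forall n, `|v n| <= 1) ->
  (forall n, (n < N)%N -> u n = v n) ->
  `|bsum b u - bsum b v| <= 2 * (b / (b - 1)) / b ^+ N.
Proof.
move=> b1; have b0 : 0 < b by lra.
elim: N u v => [|N IH] u v u1 v1 uv.
  rewrite expr0 divr1; apply: le_trans (ler_normB _ _) _.
  by rewrite mulr_natl mulr2n lerD// bsum_bound.
rewrite (bsum_recl b1 u1) (bsum_recl b1 v1) uv//.
rewrite opprD addrACA subrr add0r -mulrBl normrM normfV (gtr0_norm b0).
rewrite exprSr invfM [leRHS]mulrA ler_pM2r ?invr_gt0//.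
by apply: IH => // n nN; exact: uv.
Qed.

Lemma bsum_finite (R : realType) (b : R) (N : nat) : 1 < b ->
  bsum b (fun n => (n < N)%:R) = b / (b - 1) * (1 - b ^- N).
Proof.
move=> b1; have b0 : 0 < b by lra.
elim: N => [|N IH].
  rewrite expr0 invr1 subrr mulr0 -(@bsum_cst0 R b).
  by apply: eq_bsum => n; rewrite ltn0.
rewrite (bsum_recl (C := 1) b1); last by move=> n; exact: norm_bool_le1.
rewrite (@eq_bsum _ _ _ (fun n => (n < N)%:R))// IH.
have -> : (0 < N.+1)%N%:R = 1 :> R by [].
have bN : b ^+ N != 0 by rewrite expf_neq0//; lra.
rewrite exprS; field; rewrite bN /=; apply/andP; split; lra.
Qed.

Lemma bsum_delta (R : realType) (b : R) (k : nat) : 1 < b ->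
  bsum b (fun n => (n == k)%:R) = b ^- k.
Proof.
move=> b1; elim: k => [|k IH].
  rewrite (bsum_recl (C := 1) b1); last by move=> n; exact: norm_bool_le1.
  rewrite (@eq_bsum _ _ _ (fun=> 0))// bsum_cst0 mul0r addr0 expr0 invr1//.
rewrite (bsum_recl (C := 1) b1); last by move=> n; exact: norm_bool_le1.
by rewrite (@eq_bsum _ _ _ (fun n => (n == k)%:R))// IH add0r exprSr invfM.
Qed.

(** * The orbit of 1 and the atoms of its weighted counting measure *)

Lemma beta_transform_itv (R : realType) (b x : R) :
  0 <= beta_transform b x < 1.
Proof.
rewrite /beta_transform; have /andP[h1 h2] := floor_itv (b * x).
by rewrite intrD in h2; apply/andP; split; lra.
Qed.

Lemma beta_transform_floor (R : realType) (b x : R) (z : int) :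
  z%:~R <= b * x < z%:~R + 1 -> beta_transform b x = b * x - z%:~R.
Proof.
by move=> h; rewrite /beta_transform (@floor_def _ _ z)// intrD.
Qed.

(** The starting point 1 lies outside the range [[0, 1[] of [beta_transform], so the orbit takes the
    value 1 at index 0 only. *)
Definition orb {R : realType} (b : R) (n : nat) : R :=
  iter n (beta_transform b) 1.

Lemma orb_itv (R : realType) (b : R) (n : nat) : 0 <= orb b n.+1 < 1.
Proof. exact: beta_transform_itv. Qed.

Lemma orb_ge0 (R : realType) (b : R) (n : nat) : 0 <= orb b n.
Proof. by case: n => [|n]; [exact: ler01|case/andP: (orb_itv b n)]. Qed.

Lemma orb_le1 (R : realType) (b : R) (n : nat) : orb b n <= 1.
Proof. by case: n => [|n]; [exact: lexx|case/andP: (orb_itv b n) => _ /ltW]. Qed.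

Lemma orb_eq_shift (R : realType) (b : R) (k i j : nat) :
  orb b i = orb b j -> orb b (k + i) = orb b (k + j).
Proof. by rewrite /orb !iterD => ->. Qed.

Lemma orb_eq0_ge (R : realType) (b : R) (i j : nat) :
  orb b i = 0 -> (i <= j)%N -> orb b j = 0.
Proof.
move=> i0 /subnK <-; rewrite /orb iterD -/(orb b i) i0.
elim: (j - i)%N => //= k ->.
by rewrite (@beta_transform_floor _ _ _ 0) mulr0 ?subrr// lexx add0r ltr01.
Qed.

Lemma orb1_neq0 (R : realType) (b : R) : b \isn't a Num.int -> orb b 1 != 0.
Proof.
apply: contra => /=; rewrite /beta_transform mulr1 subr_eq0 => /eqP ->.
exact: intr_int.
Qed.

(* The jump at y, and below the value at 0, of the density
   x |-> sum_(n | r_n > x) b^-n of Parry. *)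
Definition jump {R : realType} (b y : R) : R :=
  bsum b (fun n => (orb b n == y)%:R).

Definition orb_mass {R : realType} (b : R) : R :=
  bsum b (fun n => (0 < orb b n)%R%:R).

Lemma is_cvg_bterm_bool (R : realType) (b : R) (P : nat -> bool) : 1 < b ->
  cvgn (series (bterm b (fun n => (P n)%:R))).
Proof.
by move=> b1; apply: (is_cvg_bterm (C := 1) b1) => n; exact: norm_bool_le1.
Qed.

Lemma ler_bsum_bool (R : realType) (b : R) (P Q : nat -> bool) : 1 < b ->
  (forall n, P n -> Q n) ->
  bsum b (fun n => (P n)%:R) <= bsum b (fun n => (Q n)%:R).
Proof.
move=> b1 PQ; apply: ler_bsum; [lra|exact: is_cvg_bterm_bool..|] => n.
by rewrite ler_nat; case: (P n) (PQ n) => // ->.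
Qed.

Lemma jump_ge (R : realType) (b : R) (n : nat) : 1 < b ->
  b ^- n <= jump b (orb b n).
Proof.
move=> b1; rewrite -(bsum_delta n b1); apply: ler_bsum_bool => // m /eqP ->.
exact: eqxx.
Qed.

Lemma jump_uniq (R : realType) (b : R) (n : nat) : 1 < b ->
  (forall m, orb b m = orb b n -> m = n) -> jump b (orb b n) = b ^- n.
Proof.
move=> b1 h; rewrite -(bsum_delta n b1); apply: eq_bsum => m.
congr (_%:R); congr nat_of_bool; apply/eqP/eqP => [|->//]; exact: h.
Qed.

Lemma jump_neq0 (R : realType) (b y : R) : jump b y != 0 ->
  exists n, orb b n = y.
Proof.
apply: contra_neqP => h; rewrite -(bsum_cst0 b); apply: eq_bsum => n.
by case: eqP => // e; exfalso; apply: h; exists n.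
Qed.

Lemma jump_gt0 (R : realType) (b : R) (n : nat) : 1 < b ->
  0 < jump b (orb b n).
Proof.
move=> b1; apply: lt_le_trans (jump_ge n b1).
by rewrite invr_gt0 exprn_gt0//; lra.
Qed.

Lemma orb_mass_gt0 (R : realType) (b : R) : 1 < b ->
  (forall n, orb b n != 0) -> orb_mass b = b / (b - 1).
Proof.
move=> b1 h; rewrite -bsum_cst1//; apply: eq_bsum => n.
by rewrite lt0r h orb_ge0.
Qed.

(** If two indices shared a point, the shift sending the later one to [M.+1] would send the earlier
    one to an index at most [M] where the orbit vanishes. *)
Lemma finite_orb_inj (R : realType) (b : R) (M : nat) (orbM1 : orb b M.+1 = 0)
    (orb_neq0 : forall n, (n <= M)%N -> orb b n != 0) (i j : nat) :
  (i <= M)%N -> orb b j = orb b i -> j = i.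
Proof.
move=> iM ji; have jM : (j <= M)%N.
  rewrite leqNgt; apply/negP => /(orb_eq0_ge orbM1) j0.
  by have := orb_neq0 _ iM; rewrite -ji j0 eqxx.
wlog ij : i j iM jM ji / (i <= j)%N => [H|].
  have [ij|/ltnW ij] := leqP i j; first exact: H.
  by apply/esym/H.
apply/eqP; rewrite eqn_leq ij andbT leqNgt; apply/negP => ltij.
have := orb_eq_shift (M.+1 - j) ji.
rewrite subnK ?orbM1; last by rewrite ltnW.
move=> /esym/eqP; apply/negP/orb_neq0; lia.
Qed.

Lemma finite_jump (R : realType) (b : R) (M : nat) (b1 : 1 < b)
    (orbM1 : orb b M.+1 = 0)
    (orb_neq0 : forall n, (n <= M)%N -> orb b n != 0) (i : nat) :
  (i <= M)%N -> jump b (orb b i) = b ^- i.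
Proof.
move=> iM; apply: jump_uniq => // m.
exact: (finite_orb_inj orbM1 orb_neq0 iM).
Qed.

Lemma finite_jump_pos (R : realType) (b : R) (M : nat)
    (orbM1 : orb b M.+1 = 0) (y : R) :
  0 < y -> jump b y != 0 ->
  exists2 i, (i <= M)%N & orb b i = y.
Proof.
move=> y0 /jump_neq0[i iy]; exists i => //.
rewrite leqNgt; apply/negP => /(orb_eq0_ge orbM1).
by rewrite iy; move: y0 => /lt0r_neq0/eqP.
Qed.

Lemma finite_orb_mass (R : realType) (b : R) (M : nat) (b1 : 1 < b)
    (orbM1 : orb b M.+1 = 0)
    (orb_neq0 : forall n, (n <= M)%N -> orb b n != 0) :
  orb_mass b = b / (b - 1) * (1 - b ^- M.+1).
Proof.
rewrite -bsum_finite//; apply: eq_bsum => n; rewrite lt0r orb_ge0 andbT ltnS.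
case: leqP => [/orb_neq0 -> //|/(orb_eq0_ge orbM1) ->]; by rewrite eqxx.
Qed.

Lemma finite_orbitP (R : realType) (b : R) : b \isn't a Num.int ->
  (exists n, orb b n = 0) ->
  exists M, [/\ (0 < M)%N, orb b M.+1 = 0 &
    forall n, (n <= M)%N -> orb b n != 0].
Proof.
move=> bint [n n0]; have ex : exists n, orb b n == 0 by exists n; exact/eqP.
case: (ex_minnP ex) => -[|[|M]] /eqP m0 mmin.
- by move/eqP: m0; rewrite oner_eq0.
- by move: (orb1_neq0 bint); rewrite m0 eqxx.
- exists M.+1; split => // k kM; apply/negP => /mmin; lia.
Qed.

(** The first point of the orbit of [b] is the [i]-th point of the orbit of [c], with [i > 0]
    because it is below 1; comparing jumps gives [b = c ^+ i]. *)
Lemma finite_orbits_le (R : realType) (b c : R) (M : nat) : 1 < b -> 1 < c ->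
  b \isn't a Num.int ->
  (forall y, 0 < y -> jump b y = jump c y) ->
  (forall n, (n <= M)%N -> orb c n != 0) -> orb c M.+1 = 0 ->
  jump b (orb b 1) = b^-1 -> c <= b.
Proof.
move=> b1 c1 bint jbc c0 cM jb.
have y0 : 0 < orb b 1 by rewrite lt0r orb1_neq0// orb_ge0.
have := jump_gt0 1 b1; rewrite {1}jbc// => /lt0r_neq0.
move=> /(finite_jump_pos cM y0)[i iM iy].
have : b^-1 = c ^- i by rewrite -(finite_jump c1 cM c0 iM) iy -jbc.
move/(congr1 GRing.inv); rewrite !invrK => ->.
case: i iM iy => [|i] iM iy.
  by have /andP[] := orb_itv b 0; rewrite -iy ltxx.
by rewrite exprS ler_peMr ?exprn_ege1//; lra.
Qed.

(* The last two clauses say that the two Parry densities agree. *)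
Record mixed_orbits (R : realType) (b c : R) (M : nat) : Prop := MixedOrbits {
  _ : 1 < b;
  _ : 1 < c;
  _ : (0 < M)%N;
  _ : orb b M.+1 = 0;
  _ : forall n, (n <= M)%N -> orb b n != 0;
  _ : forall n, orb c n != 0;
  _ : forall y, 0 < y -> jump b y = jump c y;
  _ : orb_mass b = orb_mass c }.

Lemma mixed_mass (R : realType) (b c : R) (M : nat) :
  mixed_orbits b c M -> b - 1 = (c - 1) * (1 - b ^- M).
Proof.
move=> H; have [b1 c1 M0 orbM1 orb_neq0 orbc_neq0 jumpbc massbc] := H.
have [bn0 bm1 cm1] : [/\ b != 0, b - 1 != 0 & c - 1 != 0] by split; lra.
have bM : b ^+ M != 0 by rewrite expf_neq0.
move: massbc; rewrite (finite_orb_mass b1 orbM1 orb_neq0) (orb_mass_gt0 c1)//.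
rewrite exprS => h.
have : b / (b - 1) * (1 - (b * b ^+ M)^-1) * ((b - 1) * (c - 1)) =
       c / (c - 1) * ((b - 1) * (c - 1)) by rewrite h.
have -> : b / (b - 1) * (1 - (b * b ^+ M)^-1) * ((b - 1) * (c - 1)) =
  (b - b ^- M) * (c - 1).
  by field; rewrite bM bn0 bm1.
have -> : c / (c - 1) * ((b - 1) * (c - 1)) = c * (b - 1) by field; lra.
by move=> ?; lra.
Qed.

Lemma mixed_lt (R : realType) (b c : R) (M : nat) :
  mixed_orbits b c M -> b < c.
Proof.
move=> H; have [b1 c1 M0 orbM1 orb_neq0 orbc_neq0 jumpbc massbc] := H.
have h := mixed_mass H.
have : 0 < b ^- M by rewrite invr_gt0 exprn_gt0//; lra.
by move=> ?; nra.
Qed.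

(** Equal jumps mean equal sets of positive orbit points, and along the injective finite orbit of
    [b] every jump is a pure power of 1/b. Index 0 is excluded because its point is 1. *)
Lemma mixed_orbc (R : realType) (b c : R) (M : nat) (n : nat) :
  mixed_orbits b c M -> exists i,
  [/\ (0 < i <= M)%N, orb b i = orb c n.+1 & jump c (orb c n.+1) = b ^- i].
Proof.
move=> H; have [b1 c1 M0 orbM1 orb_neq0 orbc_neq0 jumpbc massbc] := H.
have y0 : 0 < orb c n.+1 by rewrite lt0r orbc_neq0 orb_ge0.
have := jump_gt0 n.+1 c1; rewrite -jumpbc// => /lt0r_neq0.
move=> /(finite_jump_pos orbM1 y0)[i iM iy]; exists i; split => //.
- rewrite iM andbT; case: i iy {iM} => // iy.
  by have /andP[] := orb_itv c n; rewrite -iy ltxx.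
- by rewrite -(finite_jump b1 orbM1 orb_neq0 iM) iy jumpbc.
Qed.

Lemma mixed_orbb (R : realType) (b c : R) (M : nat) (i : nat) :
  mixed_orbits b c M -> (0 < i <= M)%N -> exists n, orb c n.+1 = orb b i.
Proof.
move=> H; have [b1 c1 M0 orbM1 orb_neq0 orbc_neq0 jumpbc massbc] := H.
case: i => // i /= iM.
have y0 : 0 < orb b i.+1 by rewrite lt0r orb_neq0 ?orb_ge0.
have := jump_gt0 i.+1 b1; rewrite jumpbc// => /lt0r_neq0 /jump_neq0[[|n] ny].
  by have /andP[] := orb_itv b i; rewrite -ny ltxx.
by exists n.
Qed.

(* If the first point of the orbit of c never recurs, then c = b^k with k >= 2;
   the mass identity then forces b^(M+1) <= b + 1, and the orbit of b cannot
   reach 0 by time M+1. *)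
Lemma mixed_recurs (R : realType) (b c : R) (M : nat) :
  mixed_orbits b c M -> exists2 m, m != 1%N & orb c m = orb c 1.
Proof.
move=> H; have [b1 c1 M0 orbM1 orb_neq0 orbc_neq0 jumpbc massbc] := H.
apply: contrapT => nrec.
have uniq m : orb c m = orb c 1 -> m = 1%N.
  by move=> h; apply/eqP/negPn/negP => m1; apply: nrec; exists m.
have [k [/andP[k0 kM] _]] := mixed_orbc 0 H.
rewrite (jump_uniq c1 uniq) => /(congr1 GRing.inv); rewrite !invrK expr1 => ck.
have bc := mixed_lt H.
have k2 : (2 <= k)%N.
  by case: k k0 {kM} ck => [//|[_ ck|//]]; move: bc; rewrite ck expr1 ltxx.
have cb2 : b ^+ 2 <= c by rewrite ck ler_weXn2l//; lra.
have M2 : (2 <= M)%N by exact: leq_trans kM.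
have hm := mixed_mass H.
have bMgt0 : 0 < b ^+ M by rewrite exprn_gt0//; lra.
have bM1 : 1 < b ^+ M by rewrite exprn_egt1//; lia.
have hm' : b ^+ M * (b - 1) = (c - 1) * (b ^+ M - 1).
  by rewrite hm; field; lra.
(* Insert [b ^+ 2 <= c] into the mass identity and cancel [b - 1]. *)
have bSM : b ^+ M * b <= b + 1.
  have : (b ^+ 2 - 1) * (b ^+ M - 1) <= b ^+ M * (b - 1).
    by rewrite hm' ler_wpM2r; lra.
  have -> : b ^+ 2 - 1 = (b - 1) * (b + 1) by ring.
  by rewrite -mulrA [leRHS]mulrC ler_pM2l; lra.
have b2M : b ^+ 2 <= b ^+ M by rewrite ler_weXn2l//; lra.
have b3 : b ^+ 2 * b <= b + 1.
  by apply: le_trans bSM; rewrite ler_wpM2r//; lra.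
have golden : b ^+ 2 < b + 1 by rewrite expr2 in b3 *; nra.
(* Multiplying by [b] and using the previous bounds: b^(M+1) (b - 1) <= b^2 - 1 < b. *)
have lt1 n : (n <= M)%N -> b ^+ n * (b - 1) < 1.
  move=> nM; have : b ^+ n <= b ^+ M by rewrite ler_weXn2l//; lra.
  move=> h; apply: (@le_lt_trans _ _ (b ^+ M * (b - 1))).
    by rewrite ler_wpM2r//; lra.
  have : b ^+ M * b * (b - 1) <= (b + 1) * (b - 1) by rewrite ler_wpM2r//; lra.
  move=> h2; have : b * (b ^+ M * (b - 1)) < b * 1.
    by rewrite mulr1; move: golden; rewrite expr2; lra.
  by rewrite ltr_pM2l//; lra.
(* The first digit is 1 because [b < 2], and the following digits are 0, so the orbit only gets
   multiplied by [b]. *)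
have orbE n : (n <= M)%N -> orb b n.+1 = b ^+ n * (b - 1).
  elim: n => [_|n IH nM].
    rewrite /orb /= (@beta_transform_floor _ _ _ 1) mulr1; first by rewrite expr0 mul1r.
    by rewrite expr2 in b3; apply/andP; split; nra.
  have -> : orb b n.+2 = beta_transform b (orb b n.+1) by [].
  rewrite IH; last exact: ltnW.
  rewrite (@beta_transform_floor _ _ _ 0) mulrA -exprS ?subr0//.
  rewrite add0r lt1// andbT mulr_ge0 ?exprn_ge0//; lra.
have := orbE M (leqnn M); rewrite orbM1 => /esym/eqP.
by rewrite mulf_eq0; apply/negP; rewrite negb_or; apply/andP; split; lra.
Qed.

(** The first point recurs at an index at least 2, since index 0 carries the point 1. Shifting this
    coincidence gives periodicity from index 1 on. *)
Lemma mixed_periodic (R : realType) (b c : R) (M : nat) :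
  mixed_orbits b c M -> exists2 p, (0 < p)%N &
  forall n, orb c (p + n.+1) = orb c n.+1.
Proof.
move=> H; have [b1 c1 M0 orbM1 orb_neq0 orbc_neq0 jumpbc massbc] := H.
have [[|[|p]]// _ h] := mixed_recurs H.
  by have /andP[] := orb_itv c 0; rewrite -h ltxx.
exists p.+1 => // n; have := orb_eq_shift n h.
by rewrite !addnS !addn0 => <-; congr (orb c _); lia.
Qed.

(* A purely periodic orbit point other than the first one has a unique
   predecessor in the orbit, so its jump is smaller by a factor c. *)
Lemma mixed_eq1 (R : realType) (b c : R) (M : nat) (i : nat) :
  mixed_orbits b c M -> (0 < i <= M)%N -> (i <= 2)%N -> orb b i = orb c 1.
Proof.
move=> H; have [b1 c1 M0 orbM1 orb_neq0 orbc_neq0 jumpbc massbc] := H.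
move=> iM i2; apply: contrapT => neq.
have [j jy] := mixed_orbb H iM.
case: j jy => [jy|j jy]; first exact/neq/esym.
have [p p0 per] := mixed_periodic H.
have /andP[i0 iM'] := iM.
have y0 : 0 < orb b i by rewrite lt0r orb_neq0// orb_ge0.
(* Index 0 contributes nothing, which frees a factor 1/c. Every other visit to the point comes from
   its unique predecessor [orb c j.+1], whose jump is b^-k with [k > 0]. *)
have : jump c (orb b i) <= b^-1 / c.
  rewrite /jump (bsum_recl (C := 1) c1) => [|n]; last exact: norm_bool_le1.
  have -> : (orb c 0 == orb b i) = false.
    by apply/negbTE/eqP => h; have /andP[] := orb_itv c j.+1; rewrite jy -h ltxx.
  rewrite add0r ler_pM2r ?invr_gt0; last by lra.
  have [k [/andP[k0 _] _ jk]] := mixed_orbc j H.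
  apply: (@le_trans _ _ (jump c (orb c j.+1))).
    apply: ler_bsum_bool => // -[|n] /eqP; first by move=> h; case: neq.
    rewrite -jy => h; rewrite -(per n) -(per j); apply/eqP.
    by have := orb_eq_shift p.-1 h; rewrite !addnS -!addSn prednK// !addSn.
  rewrite jk lef_pV2 ?posrE ?exprn_gt0//; [|lra..].
  by rewrite -[leLHS]expr1 ler_weXn2l//; lra.
rewrite -jumpbc// (finite_jump b1 orbM1 orb_neq0)//.
apply/negP; rewrite -ltNge.
(* As [b < c] and [i <= 2], the actual jump b^-i is at least b^-2 > 1 / (b c), a contradiction. *)
have : b ^- 2 <= b ^- i.
  by rewrite lef_pV2 ?posrE ?exprn_gt0//; [rewrite ler_weXn2l//; lra|lra..].
apply: lt_le_trans; rewrite expr2 invfM ltr_pM2l ?invr_gt0//; last lra.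
by have := mixed_lt H => ?; rewrite ltf_pV2 ?posrE//; lra.
Qed.

(** If [M > 1], [mixed_eq1] puts the indices 1 and 2 of an injective orbit on the same point. So
    [M = 1], and the mass identity becomes [c = b + 1]. *)
Lemma mixed_quadratic (R : realType) (b c : R) (M : nat) :
  mixed_orbits b c M -> quadratic_pair b c.
Proof.
move=> H; have [b1 c1 M0 orbM1 orb_neq0 orbc_neq0 jumpbc massbc] := H.
have e1 : orb b 1 = orb c 1 by apply: (mixed_eq1 H); rewrite ?M0.
have M1 : M = 1%N.
  apply/eqP; rewrite eqn_leq M0 andbT leqNgt; apply/negP => M2.
  have e2 : orb b 2 = orb c 1 by apply: (mixed_eq1 H); rewrite ?M2.
  by have := finite_orb_inj orbM1 orb_neq0 M0 (etrans e2 (esym e1)).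
have cb : c = b + 1.
  have := mixed_mass H; rewrite M1 expr1 => h.
  have : b * (b - 1) = (c - 1) * (b - 1) by rewrite {1}h; field; lra.
  by move=> /(mulIf _) h2; have := h2 ltac:(lra); lra.
split => //.
have := orbM1; rewrite M1; set r := orb b 1.
have r0 : 0 < r by rewrite lt0r orb_neq0 ?M1// orb_ge0.
have -> : orb b 2 = b * r - (Num.floor (b * r))%:~R by [].
have rE : r = b - (Num.floor b)%:~R by rewrite /r /orb /= /beta_transform mulr1.
have rlt1 : r < 1 by have /andP[] := orb_itv b 0.
have q1 : (1 <= Num.floor b)%R by rewrite floor_ge_int ltW.
case qE : (Num.floor b) q1 rE => [q|//] q1 rE.
case pE : (Num.floor (b * r)) => [p|p] h; last first.
  have : (0 <= Num.floor (b * r))%R by rewrite floor_ge0; nra.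
  by rewrite pE.
(* [q] and [p] are the first two digits of the expansion of 1: [orb b 2 = 0] reads b (b - q) = p,
   and [p <= q] follows from p = b r < b. *)
exists p, q; split.
- rewrite lt0n; apply/eqP => p0; rewrite p0 subr0 in h.
  by move/eqP: h; rewrite mulf_eq0; apply/negP; rewrite negb_or; apply/andP; split; lra.
- by rewrite -ltz_nat.
- rewrite -lez_nat -qE floor_ge_int.
  by have : b * r < b * 1; [rewrite ltr_pM2l//; lra | move=> ?; lra].
- by rewrite rE in h; rewrite expr2 -[RHS]h !pmulrn; ring.
Qed.


Lemma jumps_quadratic_pair (R : realType) (b c : R) : 1 < b -> 1 < c ->
  b \isn't a Num.int -> c \isn't a Num.int -> b != c ->
  (forall y, 0 < y -> jump b y = jump c y) -> orb_mass b = orb_mass c ->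
  quadratic_pair b c \/ quadratic_pair c b.
Proof.
move=> b1 c1 bint cint bc jbc mbc.
have jcb y : 0 < y -> jump c y = jump b y by move=> /jbc ->.
have inf d : ~ (exists n, orb d n = 0) -> forall n, orb d n != 0 :> R.
  by move=> h n; apply/eqP => e; apply: h; exists n.
have [fb|ib] := pselect (exists n, orb b n = 0);
  have [fc|ic] := pselect (exists n, orb c n = 0).
- have [M [M0 bM bneq]] := finite_orbitP bint fb.
  have [N [N0 cN cneq]] := finite_orbitP cint fc.
  move: bc; rewrite eq_le (finite_orbits_le _ _ cint jcb bneq bM)//; last first.
    exact: (finite_jump c1 cN cneq).
  rewrite (finite_orbits_le _ _ bint jbc cneq cN)//.
  exact: (finite_jump b1 bM bneq).
- have [M [M0 bM bneq]] := finite_orbitP bint fb.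
  by left; apply: (@mixed_quadratic _ _ _ M); split => //; exact: inf.
- have [M [M0 cM cneq]] := finite_orbitP cint fc.
  by right; apply: (@mixed_quadratic _ _ _ M); split => //; exact: inf.
- move: mbc; rewrite !orb_mass_gt0//; [|exact: inf..] => h.
  case/negP: bc; apply/eqP.
  have : b / (b - 1) * ((b - 1) * (c - 1)) = c / (c - 1) * ((b - 1) * (c - 1)).
    by rewrite h.
  have -> : b / (b - 1) * ((b - 1) * (c - 1)) = b * (c - 1) by field; lra.
  have -> : c / (c - 1) * ((b - 1) * (c - 1)) = c * (b - 1) by field; lra.
  by move=> ?; lra.
Qed.

(** * Recovering the atoms from the distribution function *)

Lemma eventually_eq_prefix (R : realType) (u : R -> nat -> R) (v : nat -> R) :
  (forall n, exists2 d, 0 < d & forall e, 0 < e <= d -> u e n = v n) ->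
  forall N, exists2 d, 0 < d &
    forall e, 0 < e <= d -> forall n, (n < N)%N -> u e n = v n.
Proof.
move=> h; elim=> [|N [d d0 IH]]; first by exists 1.
have [d' d'0 hd'] := h N; exists (Num.min d d'); first by rewrite lt_min d0.
move=> e; rewrite le_min => /and3P[e0 ed ed'] n.
rewrite ltnS leq_eqVlt => /predU1P[->|]; first by apply: hd'; rewrite e0.
by apply: IH; rewrite e0.
Qed.

(** An elementary dominated convergence as [e] tends to 0: each term is eventually constant, so for
    small [e] the first [N] terms are exact, and the tails are geometrically small. *)
Lemma bsum_transfer (R : realType) (b c k l e0 : R)
    (u u' : R -> nat -> R) (v v' : nat -> R) : 1 < b -> 1 < c -> 0 < e0 ->
  (forall e n, 0 < e <= e0 -> `|u e n| <= 1) ->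
  (forall e n, 0 < e <= e0 -> `|u' e n| <= 1) ->
  (forall n, `|v n| <= 1) -> (forall n, `|v' n| <= 1) ->
  (forall n, exists2 d, 0 < d & forall e, 0 < e <= d -> u e n = v n) ->
  (forall n, exists2 d, 0 < d & forall e, 0 < e <= d -> u' e n = v' n) ->
  (forall e, 0 < e <= e0 -> k * bsum b (u e) = l * bsum c (u' e)) ->
  k * bsum b v = l * bsum c v'.
Proof.
move=> b1 c1 e00 u1 u'1 v1 v'1 uv u'v' uu'.
pose B := `|k| * (2 * (b / (b - 1))); pose C := `|l| * (2 * (c / (c - 1))).
have bnd N : `|k * bsum b v - l * bsum c v'| <=
    geometric B b^-1 N + geometric C c^-1 N.
  have [d d0 hd] := eventually_eq_prefix uv N.
  have [d' d'0 hd'] := eventually_eq_prefix u'v' N.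
  pose e := Num.min e0 (Num.min d d').
  have ege : [/\ 0 < e <= e0, 0 < e <= d & 0 < e <= d'].
    by rewrite !lt_min e00 d0 d'0 !ge_min !lexx !orbT.
  have [ee0 ed ed'] := ege.
  have -> : k * bsum b v - l * bsum c v' =
      k * (bsum b v - bsum b (u e)) + l * (bsum c (u' e) - bsum c v').
    by rewrite !mulrBr uu'//; ring.
  apply: le_trans (ler_normD _ _) _; rewrite !normrM /geometric /= !exprVn.
  apply: lerD; rewrite -mulrA ler_wpM2l//.
    by rewrite distrC; apply: bsum_close => // n; [exact: u1|exact: hd].
  by apply: bsum_close => // n; [exact: u'1|exact: hd'].
apply/eqP; rewrite -subr_eq0 -normr_le0.
have geo0 D x : 1 < x -> geometric D x^-1 @ \oo --> (0 : R).
  move=> x1; apply: cvg_geometric; rewrite normfV gtr0_norm; last by lra.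
  by rewrite invf_lt1//; lra.
have cv : (fun N => geometric B b^-1 N + geometric C c^-1 N) @ \oo --> (0 : R).
  by rewrite -[X in _ --> X]addr0; apply: cvgD; exact: geo0.
rewrite -(cvg_lim _ cv)//; apply: limr_ge; first by apply/cvg_ex; exists 0.
exact: nearW.
Qed.

(** For [e > 0], a hat in [x] of height 1 centred at [y], zero outside [y - e, y + e], written as a
    second difference in [y] so that its sum is one of [cdf_sum]. *)
Definition tent {R : realType} (y e x : R) : R :=
  (2 * Num.min y x - Num.min (y - e) x - Num.min (y + e) x) / e.

Lemma tent_le1 (R : realType) (y e x : R) : 0 < e -> `|tent y e x| <= 1.
Proof.
move=> e0; rewrite /tent ler_norml ler_pdivlMr// ler_pdivrMr// mulN1r mul1r.
by case: (leP y x) => h1; case: (leP (y - e) x) => h2;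
  case: (leP (y + e) x) => h3; apply/andP; split; lra.
Qed.

Lemma tent_eventually (R : realType) (y x : R) :
  exists2 d, 0 < d & forall e, 0 < e <= d -> tent y e x = (x == y)%:R.
Proof.
have [->|xy] := eqVneq x y.
  exists 1 => // e /andP[e0 _]; rewrite /tent minxx.
  rewrite (min_idPl _); last by lra.
  rewrite (min_idPr _); last by lra.
  by rewrite (_ : _ - y = e) ?divff ?gt_eqF//; ring.
exists `|x - y|; first by rewrite normr_gt0 subr_eq0.
move=> e /andP[e0]; rewrite ler_normr /tent => /orP h.
apply/eqP; rewrite mulf_eq0; apply/orP; left; apply/eqP.
by case: (leP y x) => h1; case: (leP (y - e) x) => h2;
  case: (leP (y + e) x) => h3; case: h => h; lra.
Qed.

(** For [a >= 0] this is, up to normalisation, the distribution function of the Parry measure: the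
    minimum is the length of [0, a[ /\ [0, r_n[. *)
Definition cdf_sum {R : realType} (b a : R) : R :=
  bsum b (fun n => Num.min a (orb b n)).

Lemma norm_min_orb (R : realType) (b a : R) (n : nat) : 0 <= a ->
  `|Num.min a (orb b n)| <= 1.
Proof.
move=> a0; rewrite ger0_norm; last by rewrite le_min a0 orb_ge0.
by rewrite ge_min orb_le1 orbT.
Qed.

Lemma bsum_tent (R : realType) (b y e : R) : 1 < b -> 0 < e <= y ->
  bsum b (fun n => tent y e (orb b n)) =
  (2 * cdf_sum b y - cdf_sum b (y - e) - cdf_sum b (y + e)) / e.
Proof.
move=> b1 /andP[e0 ey].
have cv a : 0 <= a -> cvgn (series (bterm b (fun n => Num.min a (orb b n)))).
  by move=> a0; apply: (is_cvg_bterm (C := 1)) => // n; exact: norm_min_orb.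
have cvZ k a : 0 <= a ->
    cvgn (series (bterm b (fun n => k * Num.min a (orb b n)))).
  move=> a0; apply: (is_cvg_bterm (C := `|k|)) => // n.
  by rewrite normrM ler_piMr// norm_min_orb.
have cvD u v : cvgn (series (bterm b u)) -> cvgn (series (bterm b v)) ->
    cvgn (series (bterm b (fun n => u n + v n))).
  move=> cu cv'; rewrite (_ : series _ = series (bterm b u) \+ series (bterm b v)).
    exact: is_cvgD.
  apply/funext => n; rewrite /series /= -big_split/=.
  by apply: eq_bigr => i _; rewrite /bterm mulrDl.
have [y0 ye0 yE0] : [/\ 0 <= y, 0 <= y - e & 0 <= y + e] by split; lra.
rewrite (@eq_bsum _ _ _ (fun n => (2 / e * Num.min y (orb b n) +
    - e^-1 * Num.min (y - e) (orb b n)) + - e^-1 * Num.min (y + e) (orb b n))).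
  rewrite bsumD//; [|by apply: cvD; exact: cvZ|exact: cvZ].
  rewrite bsumD//; [|exact: cvZ..].
  rewrite (bsumZ _ (cv _ y0)) (bsumZ _ (cv _ ye0)) (bsumZ _ (cv _ yE0)).
  by rewrite -!/(cdf_sum _ _); ring.
by move=> n; rewrite /tent; ring.
Qed.

(** Take second differences at [y] and let [e] tend to 0; the restriction [e <= y] keeps [y - e] in
    the range of the hypothesis. *)
Lemma cdf_sum_jump (R : realType) (b c k l : R) : 1 < b -> 1 < c ->
  (forall a, 0 <= a -> k * cdf_sum b a = l * cdf_sum c a) ->
  forall y, 0 < y -> k * jump b y = l * jump c y.
Proof.
move=> b1 c1 kl y y0.
apply: (@bsum_transfer _ _ _ _ _ y (fun e n => tent y e (orb b n))
  (fun e n => tent y e (orb c n))) => //.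
- by move=> e n /andP[e0 _]; exact: tent_le1.
- by move=> e n /andP[e0 _]; exact: tent_le1.
- by move=> n; exact: norm_bool_le1.
- by move=> n; exact: norm_bool_le1.
- by move=> n; exact: tent_eventually.
- by move=> n; exact: tent_eventually.
move=> e /andP[e0 ey]; rewrite !bsum_tent ?e0//.
have h1 := kl y (ltW y0).
have h2 := kl (y - e) ltac:(lra); have h3 := kl (y + e) ltac:(lra).
by rewrite !mulrA !mulrBr !(mulrCA _ 2) h1 h2 h3.
Qed.

(** The same limit for the difference quotient at 0: min(e, r) / e is eventually 1 if [r > 0], and 0
    if [r = 0]. *)
Lemma cdf_sum_mass (R : realType) (b c k l : R) : 1 < b -> 1 < c ->
  (forall a, 0 <= a -> k * cdf_sum b a = l * cdf_sum c a) ->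
  k * orb_mass b = l * orb_mass c.
Proof.
move=> b1 c1 kl.
have cdfE d e : 1 < d -> 0 < e ->
    bsum d (fun n => e^-1 * Num.min e (orb d n)) = e^-1 * cdf_sum d e.
  move=> d1 e0; apply: bsumZ; apply: (is_cvg_bterm (C := 1)) => // n.
  by apply: norm_min_orb; exact: ltW.
have minE_le1 d e n : 0 < e -> `|e^-1 * Num.min e (orb d n)| <= 1.
  move=> e0; rewrite mulrC ger0_norm; last first.
    by apply: divr_ge0; rewrite ?le_min ?orb_ge0 ?(ltW e0).
  by rewrite ler_pdivrMr// mul1r ge_min lexx.
have evE d n : exists2 d', 0 < d' & forall e, 0 < e <= d' ->
    e^-1 * Num.min e (orb d n) = (0 < orb d n)%R%:R.
  have [pos|npos] := ltP 0 (orb d n).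
    exists (orb d n) => // e /andP[e0 ed]; rewrite (min_idPl ed) mulVf//.
    exact: lt0r_neq0.
  exists 1 => // e /andP[e0 _]; have -> : orb d n = 0.
    by apply/eqP; rewrite eq_le npos orb_ge0.
  by rewrite (min_idPr (ltW e0)) mulr0.
apply: (@bsum_transfer _ _ _ _ _ 1 (fun e n => e^-1 * Num.min e (orb b n))
  (fun e n => e^-1 * Num.min e (orb c n))) => //.
- by move=> e n /andP[e0 _]; exact: minE_le1.
- by move=> e n /andP[e0 _]; exact: minE_le1.
- by move=> n; exact: norm_bool_le1.
- by move=> n; exact: norm_bool_le1.
- exact: evE.
- exact: evE.
- move=> e /andP[e0 _]; rewrite !cdfE// !(mulrCA _ e^-1) kl//; exact: ltW.
Qed.

Lemma jump1 (R : realType) (b : R) : 1 < b -> jump b 1 = 1.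
Proof.
move=> b1; have := @jump_uniq _ b 0 b1; rewrite expr0 invr1; apply.
move=> [|m]// h; have /andP[_] := orb_itv b m.
by rewrite h ltxx.
Qed.

Lemma cdf_sum_quadratic_pair (R : realType) (b c k l : R) : 1 < b -> 1 < c ->
  b \isn't a Num.int -> c \isn't a Num.int -> b != c -> k != 0 ->
  (forall a, 0 <= a -> k * cdf_sum b a = l * cdf_sum c a) ->
  quadratic_pair b c \/ quadratic_pair c b.
Proof.
move=> b1 c1 bint cint bc k0 kl.
have kE : k = l.
  by have := cdf_sum_jump b1 c1 kl ltr01; rewrite !jump1// !mulr1.
rewrite -{}kE in kl.
apply: jumps_quadratic_pair => //; last exact/(mulfI k0)/cdf_sum_mass.
by move=> y y0; apply/(mulfI k0)/cdf_sum_jump.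
Qed.

(** * Lebesgue measure and one step of the beta-transformation *)

(** By uniqueness of Lebesgue measure: [b] times the pushforward has the right value on half-open
    intervals. *)
Lemma lebesgue_measure_affine (R : realType) (b k : R)
    (A : set (measurableTypeR R)) : 0 < b -> measurable A ->
  lebesgue_measure ((fun x : measurableTypeR R => b * x - k) @^-1` A) =
  (b^-1%:E * lebesgue_measure A)%E.
Proof.
move=> b0 mA; pose f (x : measurableTypeR R) : measurableTypeR R := b * x - k.
have mf : measurable_fun setT f.
  by apply: measurable_funB => //; apply: measurable_funM.
pose mu := mscale (NngNum (ltW b0)) (pushforward lebesgue_measure f).
have -> : lebesgue_measure A = mu mf A.
  apply: lebesgue_measure_unique => // _ [[x y] _ <-] /=.
  rewrite /mu /mscale /= /pushforward.
  rewrite (_ : f @^-1` `]x, y] = `](x + k) / b, (y + k) / b]%classic).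
    rewrite !lebesgue_measure_itv/= !lte_fin ltr_pM2r ?invr_gt0// ltrD2r.
    case: ifP => // _; last by rewrite mule0.
    by rewrite -!EFinB -EFinM; congr (_%:E); field; lra.
  apply/seteqP; split => z /=; rewrite /f !in_itv/= ltr_pdivrMr// ler_pdivlMr//;
    by move=> /andP[? ?]; apply/andP; split; lra.
by rewrite /mu /mscale /= /pushforward muleA -EFinM mulVf ?mul1e//; lra.
Qed.

Lemma measurable_beta_transform (R : realType) (b : R) : 0 < b ->
  measurable_fun [set: measurableTypeR R]
    (beta_transform b : measurableTypeR R -> measurableTypeR R).
Proof.
move=> b0; apply: measurable_funB; first exact: measurable_funM.
apply: nondecreasing_measurable => // x y xy.
by rewrite ler_int le_floor// ler_wpM2l// ltW.
Qed.

Lemma measurable_preimage_beta (R : realType) (b : R)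
    (E : set (measurableTypeR R)) : 0 < b -> measurable E ->
  measurable (beta_transform b @^-1` E : set (measurableTypeR R)).
Proof.
by move=> b0 mE; rewrite -[_ @^-1` _]setTI; exact: measurable_beta_transform.
Qed.

Definition len {R : realType} (E : set (measurableTypeR R)) (r : R) : R :=
  fine (lebesgue_measure (`[0, r[ `&` E)).

Lemma lebesgue_measure_co (R : realType) (x y : R) : x <= y ->
  lebesgue_measure (`[x, y[%classic : set (measurableTypeR R)) = (y - x)%:E.
Proof.
rewrite lebesgue_measure_itv/= lte_fin le_eqVlt => /predU1P[->|->//].
by rewrite ltxx subrr.
Qed.

Lemma lebesgue_measure_coI_le (R : realType) (E : set (measurableTypeR R))
    (x y : R) : measurable E -> x <= y ->
  (lebesgue_measure (`[x, y[ `&` E) <= (y - x)%:E)%E.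
Proof.
move=> mE xy; rewrite -lebesgue_measure_co//.
apply: le_measure; rewrite ?inE//=; exact: measurableI.
Qed.

Lemma lebesgue_measure_coI_fin_num (R : realType)
    (E : set (measurableTypeR R)) (x y : R) : measurable E ->
  lebesgue_measure (`[x, y[ `&` E) \is a fin_num.
Proof.
move=> mE; rewrite ge0_fin_numE//; have [xy|yx] := leP x y.
  by apply: le_lt_trans (lebesgue_measure_coI_le mE xy) _; rewrite ltry.
by rewrite set_itv_ge ?set0I ?measure0// -leNgt bnd_simp ltW.
Qed.

Lemma lenE (R : realType) (E : set (measurableTypeR R)) (r : R) :
  measurable E -> (len E r)%:E = lebesgue_measure (`[0, r[ `&` E).
Proof. by move=> mE; rewrite fineK// lebesgue_measure_coI_fin_num. Qed.

Lemma len_ge0 (R : realType) (E : set (measurableTypeR R)) (r : R) :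
  0 <= len E r.
Proof. by rewrite fine_ge0. Qed.

Lemma len_le (R : realType) (E : set (measurableTypeR R)) (r : R) :
  measurable E -> 0 <= r -> len E r <= r.
Proof.
move=> mE r0; rewrite -lee_fin lenE//.
by apply: le_trans (lebesgue_measure_coI_le mE r0) _; rewrite subr0.
Qed.

Lemma len_itv (R : realType) (a r : R) : 0 <= a -> 0 <= r ->
  len `[0, a[%classic r = Num.min a r.
Proof.
move=> a0 r0; rewrite /len.
rewrite (_ : _ `&` _ = `[0, Num.min a r[%classic); last first.
  apply/seteqP; split => x /=; rewrite !in_itv/= lt_min.
    by move=> [/andP[-> ->] /andP[_ ->]].
  by move=> /and3P[-> -> ->].
by rewrite lebesgue_measure_co ?subr0// le_min a0.
Qed.

Lemma preimage_beta_branch (R : realType) (b t : R) (k : nat) (E : set R) :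
  0 < b -> t <= 1 ->
  `[k%:R / b, (k%:R + t) / b[ `&` beta_transform b @^-1` E =
  (fun x => b * x - k%:R) @^-1` (`[0, t[ `&` E).
Proof.
move=> b0 t1; apply/seteqP; split => x /=; rewrite !in_itv/=.
  move=> [/andP[]]; rewrite ler_pdivrMr// ltr_pdivlMr// => h1 h2.
  rewrite (@beta_transform_floor _ _ _ k) ?pmulrn; last by rewrite -pmulrn; lra.
  by split => //; lra.
move=> [/andP[h1 h2] Ex]; split; first by rewrite ler_pdivrMr// ltr_pdivlMr//; lra.
by rewrite (@beta_transform_floor _ _ _ k) -?pmulrn//; lra.
Qed.

(** Every full branch contributes [len E 1 / b], the last partial one [len E t / b]. Allowing
    [t = 1] lets the induction hypothesis cover the full branches exactly. *)
Lemma len_preimage_beta_branches (R : realType) (b t : R) (k : nat)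
    (E : set (measurableTypeR R)) : 0 < b -> 0 <= t <= 1 -> measurable E ->
  len (beta_transform b @^-1` E) ((k%:R + t) / b) =
  (k%:R * len E 1 + len E t) / b.
Proof.
move=> b0 t01 mE; have mTE := measurable_preimage_beta b0 mE.
have br j s : 0 <= s <= 1 -> lebesgue_measure
    (`[j%:R / b, (j%:R + s) / b[ `&` beta_transform b @^-1` E) =
    (len E s / b)%:E.
  move=> /andP[s0 s1]; rewrite preimage_beta_branch//.
  rewrite (@lebesgue_measure_affine _ b j%:R)//; last exact: measurableI.
  by rewrite -lenE// -EFinM mulrC.
elim: k t t01 => [|k IH] t t01.
  have := br 0%N t t01; rewrite !mul0r !add0r => h.
  by rewrite /len h.
have /andP[t0 t1] := t01.
apply: EFin_inj; rewrite lenE//.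
have kk : k.+1%:R / b = (k%:R + 1) / b by rewrite -natr1.
have k0 : 0 <= k%:R / b by rewrite divr_ge0// ltW.
have kt : k.+1%:R / b <= (k.+1%:R + t) / b.
  by rewrite ler_pM2r ?invr_gt0//; lra.
have k1 : 0 <= k.+1%:R / b by rewrite divr_ge0// ltW.
rewrite (_ : `[0, (k.+1%:R + t) / b[ =
    `[0, k.+1%:R / b[ `|` `[k.+1%:R / b, (k.+1%:R + t) / b[)%classic; last first.
  apply/seteqP; split => x /=; rewrite !in_itv/=; lra.
rewrite setIUl measureU//; [|exact: measurableI|exact: measurableI|]; last first.
  apply/seteqP; split => x //= -[[h1 _] [h2 _]]; move: h1 h2.
  by rewrite !in_itv/=; lra.
rewrite -[X in (X + _)%E]/(lebesgue_measure _).
rewrite -[X in (_ + X)%E]/(lebesgue_measure _) br// -lenE// kk IH; last first.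
  by rewrite lexx ler01.
by rewrite -EFinD -natr1; congr (_%:E); ring.
Qed.

Lemma len_preimage_beta (R : realType) (b r : R)
    (E : set (measurableTypeR R)) : 0 < b -> 0 <= r -> measurable E ->
  len (beta_transform b @^-1` E) r =
  ((Num.floor (b * r))%:~R * len E 1 + len E (beta_transform b r)) / b.
Proof.
move=> b0 r0 mE.
have : (0 <= Num.floor (b * r))%R by rewrite floor_ge0 mulr_ge0// ltW.
case kE : (Num.floor (b * r)) => [k|//] _.
have /andP[t0 t1] := beta_transform_itv b r.
rewrite -pmulrn -len_preimage_beta_branches// ?t0 ?ltW//.
congr (len _ _); rewrite /beta_transform kE -pmulrn; field; lra.
Qed.

(** * Ergodicity *)

Lemma len_le_mod0 (R : realType) (E F : set (measurableTypeR R)) (r : R) :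
  measurable E -> measurable F -> r <= 1 ->
  lebesgue_measure (`[0, 1[ `&` (E `\` F)) = 0%E -> len E r <= len F r.
Proof.
move=> mE mF r1 EF0; rewrite -lee_fin !lenE//.
rewrite -[leRHS]adde0 -EF0; apply: le_trans (measureU2 _ _ _); last 2 first.
- exact: measurableI.
- by apply: measurableI => //; exact: measurableD.
apply: le_measure; rewrite ?inE//; first exact: measurableI.
- by apply: measurableU; apply: measurableI => //; exact: measurableD.
- move=> x [x0r Ex]; have [Fx|Fx] := pselect (F x); [by left|right].
  split => //; move: x0r; rewrite /= !in_itv/= => /andP[-> xr]/=.
  exact: lt_le_trans r1.
Qed.

(** Proportionality on the intervals [0, a[ says that two finite measures agree on the rays []-oo,
    x[], a generating pi-system, hence on all Borel sets. *)
Lemma len_linear_indep (R : realType) (E : set (measurableTypeR R)) :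
  measurable E -> (forall a, 0 <= a <= 1 -> len E a = a * len E 1) ->
  forall A : set (measurableTypeR R), measurable A ->
  lebesgue_measure (A `&` (`[0, 1[ `&` E)) =
  ((len E 1)%:E * lebesgue_measure (A `&` `[0%R, 1%R[))%E.
Proof.
move=> mE lin A mA.
have m01 : measurable (`[0, 1[%classic : set (measurableTypeR R)) by [].
pose m1 : {measure set (measurableTypeR R) -> \bar R} :=
  mrestr lebesgue_measure (measurableI _ _ m01 mE).
pose m2 : {measure set (measurableTypeR R) -> \bar R} :=
  mscale (NngNum (len_ge0 E 1)) (mrestr lebesgue_measure m01).
have : m1 A = m2 A; last by [].
apply: (@measure_unique _ R (measurableTypeR R) (@RGenInftyO.G R)
  (fun n => `]-oo, n%:R[%classic) _ _ _ _ m1 m2) => //.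
- exact: RGenInftyO.measurableE.
- move=> _ _ [x ->] [y ->]; exists (Num.min x y); apply/seteqP.
  by split => z /=; rewrite !in_itv/= lt_min => /andP.
- by move=> n; exists n%:R.
- apply/seteqP; split => // x _; exists (Num.truncn `|x|).+1 => //=.
  by rewrite in_itv/=; apply: le_lt_trans (ler_norm x) (truncnS_gt _).
- move=> _ [x ->]; pose a := Num.max 0 (Num.min x 1).
  have a01 : 0 <= a <= 1.
    by rewrite /a le_max lexx ge_max ler01 ge_min lexx orbT.
  have aE : `]-oo, x[ `&` `[0, 1[ = `[0, a[%classic.
    apply/seteqP; split => z /=; rewrite !in_itv/= /a lt_max lt_min.
      by move=> [-> /andP[-> ->]]; rewrite orbT.
    move=> /andP[z0] /orP[|/andP[-> ->]]; last by rewrite z0.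
    by rewrite ltNge z0.
  rewrite /m1 /m2 /= /mscale /= /mrestr setIA aE -lenE// lin//.
  by have /andP[a0 _] := a01; rewrite lebesgue_measure_co// subr0 EFinM muleC.
- move=> n; apply: (@le_lt_trans _ _ (lebesgue_measure (`[0%R, 1%R[ `&` E))).
    by apply: le_measure; rewrite ?inE//; [do 2?apply: measurableI|exact: measurableI].
  by rewrite -lenE// ltry.
Qed.

(** Invariance is assumed only up to null sets, which is what is known of the superlevel set of a
    density to which this is applied. *)
Lemma beta_ergodic (R : realType) (b : R) (E : set (measurableTypeR R)) :
  1 < b -> measurable E ->
  lebesgue_measure (`[0, 1[ `&` (E `\` beta_transform b @^-1` E)) = 0%E ->
  lebesgue_measure (`[0, 1[ `&` (beta_transform b @^-1` E `\` E)) = 0%E ->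
  lebesgue_measure (`[0%R, 1%R[ `&` E) = 0%E \/
  lebesgue_measure (`[0%R, 1%R[ `&` ~` E) = 0%E.
Proof.
move=> b1 mE h1 h2; have b0 : 0 < b by lra.
have mTE := measurable_preimage_beta b0 mE.
pose psi a := len E a - a * len E 1.
have psiT a : 0 <= a <= 1 -> psi a = psi (beta_transform b a) / b.
  move=> /andP[a0 a1]; rewrite /psi.
  have -> : len E a = len (beta_transform b @^-1` E) a.
    by apply/eqP; rewrite eq_le !len_le_mod0.
  by rewrite len_preimage_beta// {3}/beta_transform; field; lra.
(* The bound 1 improves by a factor 1/b at each application of [psiT], so [psi] vanishes on
   [0, 1]. *)
have psi_le n : forall a, 0 <= a <= 1 -> `|psi a| <= geometric 1 b^-1 n.
  elim: n => [|n IH] a a01.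
    have /andP[a0 a1] := a01.
    rewrite /geometric /= expr0 mulr1 /psi ler_norml.
    have := len_le mE a0; have := len_le mE (@ler01 R).
    have := len_ge0 E a; have := len_ge0 E 1; nra.
  rewrite psiT// normrM normfV (gtr0_norm b0) /geometric /= exprSr mulrA.
  rewrite ler_pM2r ?invr_gt0//; apply: IH.
  by have /andP[-> /ltW] := beta_transform_itv b a.
have lin a : 0 <= a <= 1 -> len E a = a * len E 1.
  move=> a01; apply/eqP; rewrite -subr_eq0 -normr_le0.
  have cv : geometric 1 b^-1 @ \oo --> (0 : R).
    by apply: cvg_geometric; rewrite normfV gtr0_norm// invf_lt1.
  rewrite -(cvg_lim _ cv)//; apply: limr_ge; first by apply/cvg_ex; exists 0.
  by apply: nearW => n; exact: psi_le.
(* With the complement of [E] as test set, independence of [E] from itself reads 0 = l(E) l(~E) on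
   [0, 1[. *)
have := len_linear_indep mE lin (measurableC mE).
rewrite (_ : ~` E `&` _ = set0); last first.
  by apply/seteqP; split => x // -[nEx [_ /nEx]].
rewrite measure0 => /esym/eqP; rewrite mule_eq0 => /orP[]/eqP.
  by rewrite lenE//; left.
by rewrite setIC; right.
Qed.

(** * Uniqueness of the invariant measure *)

(** Finiteness of [nu D] allows subtracting it: [f - 1] then has zero integral over [D] although it
    is positive there. *)
Lemma integral_gt1_null d (T : measurableType d) (R : realType)
    (nu : {finite_measure set T -> \bar R}) (f : T -> \bar R) (D : set T) :
  measurable D -> measurable_fun setT f -> (forall x, f x \is a fin_num) ->
  (forall x, D x -> (1 < f x)%E) -> (\int[nu]_(x in D) f x <= nu D)%E ->
  nu D = 0%E.
Proof.
move=> mD mf ffin f1 fle.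
have mfD : measurable_fun D f by exact: measurable_funTS.
have mg : measurable_fun D (fun x => f x - 1)%E.
  exact: emeasurable_funB.
have g0 x : D x -> (0 <= f x - 1)%E.
  by move=> Dx; rewrite sube_ge0// ltW// f1.
have int1 : (\int[nu]_(x in D) (1 : \bar R))%E = nu D.
  by rewrite integral_cst// mul1e.
have split_f : (\int[nu]_(x in D) f x = \int[nu]_(x in D) (f x - 1) + nu D)%E.
  rewrite -int1 -ge0_integralD//.
  by apply: eq_integral => x _; rewrite subeK.
have nuD : nu D \is a fin_num by exact: fin_num_measure.
have g_int0 : (\int[nu]_(x in D) (f x - 1) = 0)%E.
  apply/eqP; rewrite eq_le integral_ge0// andbT.
  by move: fle; rewrite split_f -[leRHS]add0e leeD2rE.
have : ae_eq nu D (fun x => f x - 1)%E (cst 0%E).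
  apply/(ae_eq_integral_abs nu mD mg); rewrite -[RHS]g_int0.
  by apply: eq_integral => x /[!inE] Dx; rewrite gee0_abs// g0.
move=> [N [mN N0 DN]]; apply: (subset_measure0 _ _ _ N0) => // x Dx.
apply: DN => /= /(_ Dx) fx1.
have : (0 < f x - 1)%E by rewrite sube_gt0 f1.
by rewrite [X in (_ < X)%E]fx1 ltxx.
Qed.

Lemma measure_symD_eq d (T : measurableType d) (R : realType)
    (mu : {finite_measure set T -> \bar R}) (A B : set T) :
  measurable A -> measurable B -> mu A = mu B -> mu (A `\` B) = mu (B `\` A).
Proof.
move=> mA mB muAB.
have fin : mu (A `&` B) \is a fin_num by apply: fin_num_measure; exact: measurableI.
have h1 := measureDI mu mA mB; have h2 := measureDI mu mB mA.
rewrite (setIC B A) in h2; rewrite -[LHS](addeK _ fin) -[RHS](addeK _ fin).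
congr (_ - _)%E; exact: etrans (esym h1) (etrans muAB h2).
Qed.

(* With f the density of m with respect to nu, the set {f > 1} is invariant
   up to null sets, so it is null by ergodicity, whence m <= nu. *)
Lemma invariant_measure_unique (R : realType) (b : R)
    (nu m : {finite_measure set (measurableTypeR R) -> \bar R}) : 1 < b ->
  (forall A : set (measurableTypeR R), measurable A ->
     nu (beta_transform b @^-1` A) = nu A) ->
  (forall A : set (measurableTypeR R), measurable A ->
     m (beta_transform b @^-1` A) = m A) ->
  (forall A : set (measurableTypeR R), measurable A ->
     lebesgue_measure (`[0%R, 1%R[ `&` A) = 0%E <-> nu A = 0%E) ->
  m `<< nu -> m setT = nu setT ->
  forall A : set (measurableTypeR R), measurable A -> m A = nu A.
Proof.
move=> b1 nuinv minv nulambda mnu mT; have b0 : 0 < b by lra.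
pose f := Radon_Nikodym_SigmaFinite.f m nu.
have f0 x : (0 <= f x)%E by exact: Radon_Nikodym_SigmaFinite.f_ge0.
have ffin x : f x \is a fin_num by exact: Radon_Nikodym_SigmaFinite.f_fin_num.
have mf : measurable_fun setT f.
  exact: measurable_int (Radon_Nikodym_SigmaFinite.f_integrable mnu).
have fE (A : set (measurableTypeR R)) : measurable A ->
    m A = (\int[nu]_(x in A) f x)%E.
  exact: Radon_Nikodym_SigmaFinite.f_integral.
pose P := [set x : measurableTypeR R | (1 < f x)%E].
have mP : measurable P.
  by rewrite /P -[X in measurable X]setTI; exact: emeasurable_fun_o_infty.
have mTP := measurable_preimage_beta b0 mP.
have le_out (D : set (measurableTypeR R)) : measurable D ->
    D `&` P = set0 -> (m D <= nu D)%E.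
  move=> mD DP; rewrite fE// -[leRHS]mul1e -integral_cst//.
  apply: ge0_le_integral => //; [exact: measurable_funTS|].
  move=> x Dx; rewrite leNgt; apply/negP => fx.
  by have : (D `&` P) x by []; rewrite DP.
have null_in (D : set (measurableTypeR R)) : measurable D ->
    D `<=` P -> (m D <= nu D)%E -> nu D = 0%E.
  move=> mD DP mDle; apply: (integral_gt1_null mD mf ffin) => //.
  by rewrite -fE.
have mD1 : measurable (P `\` beta_transform b @^-1` P) by exact: measurableD.
have mD2 : measurable (beta_transform b @^-1` P `\` P) by exact: measurableD.
have nuD := measure_symD_eq mP mTP (esym (nuinv _ mP)).
have mD := measure_symD_eq mP mTP (esym (minv _ mP)).
(* By invariance both differences have equal mass, under [m] and under [nu]. As m <= nu outside [P],
   the same holds on this part of [P], where the density exceeds 1. *)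
have nuD1 : nu (P `\` beta_transform b @^-1` P) = 0%E.
  apply: null_in => //.
  rewrite mD nuD; apply: le_out => //.
  by apply/seteqP; split => // x [[]].
have nuP : nu P = 0%E.
  have [/(nulambda _ mP).1 //|/(nulambda _ (measurableC mP)).1 nuPC] :=
    beta_ergodic b1 mP ((nulambda _ mD1).2 nuD1)
      ((nulambda _ mD2).2 (etrans (esym nuD) nuD1)).
  (* If instead the complement of [P] is null, then m(P) <= m(setT) = nu(setT) = nu(P), so [P] is
     null here too. *)
  apply: null_in => //; apply: (@le_trans _ _ (m setT)).
    by apply: le_measure; rewrite ?inE.
  rewrite mT -(setvU P); apply: le_trans (measureU2 _ _ _) _ => //.
    exact: measurableC.
  by rewrite [X in (X + _)%E](_ : _ = 0%E) ?add0e.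
have mPnull : m P = 0%E by apply: (null_content_dominatesP m nu).1 nuP.
have mle (A : set (measurableTypeR R)) : measurable A -> (m A <= nu A)%E.
  move=> mA; rewrite (measureDI m mA mP) (measureDI nu mA mP).
  rewrite (@subset_measure0 _ _ _ m (A `&` P) P)//; [|exact: measurableI].
  rewrite adde0; apply: (@le_trans _ _ (nu (A `\` P))); last exact: leeDl.
  apply: le_out; first exact: measurableD.
  by apply/seteqP; split => // x [[]].
(* Since the total masses agree, the reverse inequality is [mle] on the complement. *)
move=> A mA; apply/eqP; rewrite eq_le mle//=.
have mAC := measurableC mA.
have tot (k : {finite_measure set (measurableTypeR R) -> \bar R}) :
    fine (k setT) = fine (k A) + fine (k (~` A)).
  rewrite -fineD ?fin_num_measure//.
  by rewrite -[setT](setUv A) measureU// setICr.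
have leC : fine (m (~` A)) <= fine (nu (~` A)).
  by apply: fine_le; rewrite ?fin_num_measure ?mle.
rewrite -(fineK (fin_num_measure nu _ mA)) -(fineK (fin_num_measure m _ mA)).
by rewrite lee_fin; have := tot m; have := tot nu; rewrite mT; lra.
Qed.

(** * Parry's formula *)

Lemma norm_orb_le1 (R : realType) (b : R) (n : nat) : `|orb b n| <= 1.
Proof. by rewrite ger0_norm ?orb_ge0// orb_le1. Qed.

Lemma norm_len_orb (R : realType) (b : R) (A : set (measurableTypeR R))
  (n : nat) : measurable A -> `|len A (orb b n)| <= 1.
Proof.
move=> mA; rewrite ger0_norm ?len_ge0//.
exact: le_trans (len_le mA (orb_ge0 b n)) (orb_le1 b n).
Qed.

Lemma bsum_orb_gt0 (R : realType) (b : R) : 1 < b -> 0 < bsum b (orb b).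
Proof.
move=> b1; apply: (@lt_le_trans _ _ (bsum b (fun n => (n == 0%N)%:R))).
  by rewrite bsum_delta// expr0 invr1.
apply: ler_bsum; [lra|exact: is_cvg_bterm_bool| |].
  exact: (is_cvg_bterm b1 (norm_orb_le1 b)).
by move=> [|n]; [exact: lexx|exact: orb_ge0].
Qed.

(** Parry's measure, written without its density: the series of Lebesgue measures on [0, r_n[ with
    weights b^-n / K, where K = sum r_n b^-n. *)
Lemma parry_measure_exists (R : realType) (b : R) : 1 < b ->
  exists m : {finite_measure set (measurableTypeR R) -> \bar R},
  forall A : set (measurableTypeR R), measurable A ->
  m A = ((bsum b (orb b))^-1 * bsum b (fun n => len A (orb b n)))%:E.
Proof.
move=> b1; have b0 : 0 < b by lra.
have K0 := bsum_orb_gt0 b1; set K := bsum b (orb b) in K0 *.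
have c0 n : 0 <= K^-1 / b ^+ n.
  by rewrite divr_ge0 ?invr_ge0 ?exprn_ge0// ltW.
have mitv n : measurable (`[0, orb b n[%classic : set (measurableTypeR R)) by [].
pose mn n : {measure set (measurableTypeR R) -> \bar R} :=
  mscale (NngNum (c0 n)) (mrestr lebesgue_measure (mitv n)).
pose m : {measure set (measurableTypeR R) -> \bar R} := mseries mn 0.
have mE (A : set (measurableTypeR R)) : measurable A ->
    m A = (K^-1 * bsum b (fun n => len A (orb b n)))%:E.
  move=> mA.
  have cv : cvgn (series (bterm b (fun n => len A (orb b n)))).
    by apply: (is_cvg_bterm b1) => n; exact: norm_len_orb.
  have cvK : cvgn (series (bterm b (fun n => K^-1 * len A (orb b n)))).
    apply: (is_cvg_bterm (C := K^-1) b1) => n.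
    by rewrite normrM normfV (gtr0_norm K0) ler_piMr ?norm_len_orb// invr_ge0 ltW.
  rewrite -(bsumZ K^-1 cv) /bsum -EFin_lim//.
  rewrite /m /= /mseries; congr (limn _); apply/funext => N.
  rewrite /series /= -sumEFin; apply: eq_bigr => n _.
  rewrite /mn /= /mscale /= /mrestr setIC -lenE// -EFinM /bterm.
  by rewrite mulrAC.
have mfin : fin_num_fun m by move=> A mA; rewrite mE.
pose mf : {finite_measure set (measurableTypeR R) -> \bar R} :=
  HB.pack_for (FiniteMeasure.type (measurableTypeR R) R) (mseries mn 0)
    (Measure_isFinite.Build _ _ _ (mseries mn 0) mfin).
by exists mf => A mA; exact: mE.
Qed.

(** The digit floor(b r_n) equals b r_n - r_(n+1), so the sum telescopes to b r_0; this is [b] times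
    the expansion of 1 in base [b]. *)
Lemma bsum_floor_orb (R : realType) (b : R) : 1 < b ->
  bsum b (fun n => (Num.floor (b * orb b n))%:~R) = b.
Proof.
move=> b1; have b0 : b != 0 by lra.
have cv := is_cvg_bterm b1 (norm_orb_le1 b).
have cvS : cvgn (series (bterm b (fun n => orb b n.+1))).
  by apply: (is_cvg_bterm b1) => n; exact: norm_orb_le1.
rewrite (@eq_bsum _ _ _ (fun n => b * orb b n + -1 * orb b n.+1)); last first.
  move=> n; rewrite -[orb b n.+1]/(beta_transform b (orb b n)).
  by rewrite /beta_transform; ring.
rewrite bsumD; first last.
- by apply: (is_cvg_bterm (C := 1) b1) => n; rewrite mulN1r normrN norm_orb_le1.
- apply: (is_cvg_bterm (C := b) b1) => n.
  by rewrite normrM ger0_norm ?ler_piMr ?norm_orb_le1//; lra.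
rewrite (bsumZ b cv) (bsumZ (-1) cvS) (bsum_recl b1 (norm_orb_le1 b)).
by rewrite /orb /=; field.
Qed.

(** The one-step formula splits each term into a digit part and a shifted part. The digits sum to
    [b], so their part is [len A 1], the index-0 term missing from the shifted sum. *)
Lemma bsum_len_invariant (R : realType) (b : R)
    (A : set (measurableTypeR R)) : 1 < b -> measurable A ->
  bsum b (fun n => len (beta_transform b @^-1` A) (orb b n)) =
  bsum b (fun n => len A (orb b n)).
Proof.
move=> b1 mA; have b0 : 0 < b by lra.
have cvS : cvgn (series (bterm b (fun n => len A (orb b n.+1)))).
  by apply: (is_cvg_bterm b1) => n; exact: norm_len_orb.
have fl n : `|(Num.floor (b * orb b n))%:~R : R| <= b.
  have bo : 0 <= b * orb b n by rewrite mulr_ge0 ?orb_ge0// ltW.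
  rewrite ger0_norm ?ler0z ?floor_ge0//; apply: le_trans (floor_le _) _.
  by rewrite ler_piMr ?orb_le1// ltW.
have cvf := is_cvg_bterm b1 fl.
rewrite [RHS](bsum_recl b1 (fun n => norm_len_orb b n mA)).
rewrite (@eq_bsum _ _ _ (fun n => len A 1 / b * (Num.floor (b * orb b n))%:~R +
    b^-1 * len A (orb b n.+1))); last first.
  move=> n; rewrite len_preimage_beta ?orb_ge0//.
  by rewrite -[orb b n.+1]/(beta_transform b (orb b n)); ring.
rewrite bsumD; first last.
- apply: (is_cvg_bterm (C := b^-1) b1) => n.
  by rewrite normrM normfV (gtr0_norm b0) ler_piMr ?norm_len_orb// invr_ge0 ltW.
- apply: (is_cvg_bterm (C := `|len A 1 / b| * b) b1) => n.
  by rewrite normrM ler_wpM2l.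
rewrite (bsumZ _ cvf) (bsumZ _ cvS) bsum_floor_orb//.
by rewrite /orb /=; field; lra.
Qed.

Lemma len_setT (R : realType) (r : R) : 0 <= r -> len setT r = r.
Proof. by move=> r0; rewrite /len setIT lebesgue_measure_co// subr0. Qed.

Section renyi_parry.
Variables (R : realType) (b : R) (nu : probability (measurableTypeR R) R).
Hypothesis nuP : is_Renyi_Parry b nu.

Lemma renyi_parry_setI (A : set (measurableTypeR R)) : measurable A ->
  nu (`[0, 1[ `&` A) = nu A.
Proof.
move=> mA; have [nu01 _ _ _] := nuP.
have m01 : measurable (`[0, 1[%classic : set (measurableTypeR R)) by [].
have nuC : nu (~` `[0, 1[) = 0%E by rewrite probability_setC// nu01 subee.
rewrite [RHS](measureDI nu mA m01) setIC.
rewrite (@subset_measure0 _ _ _ nu (A `\` `[0, 1[) (~` `[0, 1[)) ?add0e//.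
  exact: measurableD.
exact: measurableC.
Qed.

(** Invariance passes from subsets of [0, 1[ to all Borel sets because [nu] ignores the outside of
    [0, 1[ and [beta_transform] takes its values inside. *)
Lemma renyi_parry_invariant (A : set (measurableTypeR R)) : 0 < b ->
  measurable A -> nu (beta_transform b @^-1` A) = nu A.
Proof.
move=> b0 mA; have [_ inv _ _] := nuP.
have m01 : measurable (`[0, 1[%classic : set (measurableTypeR R)) by [].
have mA01 : measurable (`[0, 1[ `&` A) by exact: measurableI.
rewrite -(renyi_parry_setI mA) -[RHS]inv//.
rewrite -renyi_parry_setI; last exact: measurable_preimage_beta.
congr (nu _); rewrite preimage_setI; congr (_ `&` _).
apply/seteqP; split => [x h|x []//]; split => //=.
by rewrite in_itv/= beta_transform_itv.
Qed.

Lemma renyi_parry_null (A : set (measurableTypeR R)) : measurable A ->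
  lebesgue_measure (`[0%R, 1%R[ `&` A) = 0%E <-> nu A = 0%E.
Proof.
move=> mA; have [_ _ nul lnu] := nuP; rewrite setIC; split => A0.
  exact: (null_content_dominatesP _ _).1 nul _ mA A0.
exact: (null_content_dominatesP _ _).1 lnu _ mA A0.
Qed.

(** Parry's measure is invariant, of mass 1, and dominated by [nu] because every r_n is at most 1;
    uniqueness identifies it with [nu]. *)
Lemma renyi_parryE (A : set (measurableTypeR R)) : 1 < b -> measurable A ->
  nu A = ((bsum b (orb b))^-1 * bsum b (fun n => len A (orb b n)))%:E.
Proof.
move=> b1 mA; have b0 : 0 < b by exact: lt_trans b1.
have [m mE] := parry_measure_exists b1.
rewrite -mE//; apply/esym.
apply: (invariant_measure_unique (nu := nu) b1) => //.
- by move=> B mB; exact: renyi_parry_invariant.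
- move=> B mB; rewrite !mE//; last exact: measurable_preimage_beta.
  by rewrite bsum_len_invariant.
- exact: renyi_parry_null.
- apply/null_content_dominatesP => B mB /(renyi_parry_null mB) lB.
  rewrite mE// [X in _ * X](_ : _ = 0) ?mulr0// -(bsum_cst0 b).
  apply: eq_bsum => n.
  apply/eqP; rewrite eq_le len_ge0 andbT -lee_fin lenE//.
  apply: (@le_trans _ _ (lebesgue_measure (`[0%R, 1%R[ `&` B))); last by rewrite lB.
  apply: le_measure; rewrite ?inE; try exact: measurableI.
  apply: setSI => x /=; rewrite !in_itv/= => /andP[-> xo]/=.
  exact: lt_le_trans xo (orb_le1 b n).
- transitivity (1%E : \bar R); last exact/esym/(@probability_setT _ _ _ nu).
  rewrite mE// [X in _ * X](_ : _ = bsum b (orb b)).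
    by rewrite mulVf//; exact/lt0r_neq0/bsum_orb_gt0.
  by apply: eq_bsum => n; rewrite len_setT ?orb_ge0.
Qed.

End renyi_parry.

Lemma coincide_quadratic_pair (R : realType) (b c : R)
    (nu mu : probability (measurableTypeR R) R) : 1 < b -> 1 < c ->
  b \isn't a Num.int -> c \isn't a Num.int -> b != c ->
  is_Renyi_Parry b nu -> is_Renyi_Parry c mu -> measures_coincide nu mu ->
  quadratic_pair b c \/ quadratic_pair c b.
Proof.
move=> b1 c1 bint cint bc nuP muP numu.
apply: (@cdf_sum_quadratic_pair _ b c (bsum b (orb b))^-1 (bsum c (orb c))^-1) => //.
  by rewrite invr_eq0; exact/lt0r_neq0/bsum_orb_gt0.
move=> a a0; have ma : measurable (`[0, a[%classic : set (measurableTypeR R)) by [].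
have cdfE d : cdf_sum d a = bsum d (fun n => len `[0, a[%classic (orb d n)).
  by apply: eq_bsum => n; rewrite len_itv ?orb_ge0.
apply: EFin_inj; rewrite !cdfE -(renyi_parryE nuP)// -(renyi_parryE muP)//.
exact: numu.
Qed.

(** * Quadratic pairs have the same measure *)

Lemma quadratic_pair_root (R : realType) (b c : R) : 1 < b ->
  quadratic_pair b c -> exists p q : nat,
  [/\ 0 < b - q%:R < 1, b * (b - q%:R) = p%:R & c = b + 1].
Proof.
move=> b1 [[p [q [p0 q0 pq bE]]] cE]; exists p, q.
have bp : b * (b - q%:R) = p%:R.
  by apply/eqP; rewrite -subr_eq0 -[X in _ == X]bE; apply/eqP; ring.
have pR : 0 < p%:R :> R by rewrite ltr0n.
have pqR : p%:R <= q%:R :> R by rewrite ler_nat.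
split => //; apply/andP; split.
  by rewrite -(pmulr_rgt0 _ (lt_trans ltr01 b1)) bp.
have bq : q%:R < b.
  by rewrite -subr_gt0 -(pmulr_rgt0 _ (lt_trans ltr01 b1)) bp.
have b0 : 0 < b by lra.
by rewrite -(ltr_pM2l b0) mulr1 bp; exact: le_lt_trans bq.
Qed.

(** With r = b - q, the product b r = p is an integer, so the orbit of [b] reaches 0 at index 2,
    while c r = p + r makes r a fixed point for [c]. *)
Lemma quadratic_pair_orb (R : realType) (b c : R) : 1 < b ->
  quadratic_pair b c -> exists r,
  [/\ orb b 1 = r, forall n, orb b n.+2 = 0 & forall n, orb c n.+1 = r].
Proof.
move=> b1 /(quadratic_pair_root b1)[p [q [/andP[r0 r1] bp cE]]].
exists (b - q%:R).
have b_1 : orb b 1 = b - q%:R.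
  rewrite /orb /= (@beta_transform_floor _ _ _ q) ?mulr1 -?pmulrn//; lra.
split => // n.
- apply: (@orb_eq0_ge _ _ 2) => //.
  rewrite -[orb b 2]/(beta_transform b (orb b 1)) b_1.
  rewrite (@beta_transform_floor _ _ _ p) bp -?pmulrn ?subrr//.
  by rewrite lexx ltrDl ltr01.
- elim: n => [|n IH].
    rewrite /orb /= (@beta_transform_floor _ _ _ q.+1) ?mulr1 -?pmulrn -?natr1 cE.
      by ring.
    by lra.
  rewrite -[orb c n.+2]/(beta_transform c (orb c n.+1)) IH.
  have cr : c * (b - q%:R) = p%:R + (b - q%:R) by rewrite cE -bp; ring.
  by rewrite (@beta_transform_floor _ _ _ p) cr -?pmulrn; [ring|lra].
Qed.

(** Both sums equal u(1) + u(r) / b, because the geometric tail for [c] sums to 1 / (c - 1) = 1 / b.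
    It serves both the normalising constant and the numerator of Parry's formula. *)
Lemma quadratic_pair_bsum (R : realType) (b c : R) (u : R -> R) :
  1 < b -> quadratic_pair b c -> u 0 = 0 ->
  (forall x, 0 <= x <= 1 -> `|u x| <= 1) ->
  bsum b (fun n => u (orb b n)) = bsum c (fun n => u (orb c n)).
Proof.
move=> b1 bc u0 u1; have [r [b_1 b_2 c_1]] := quadratic_pair_orb b1 bc.
have cE : c = b + 1 by case: bc.
have c1 : 1 < c by lra.
have ub d n : `|u (orb d n)| <= 1 by apply: u1; rewrite orb_ge0 orb_le1.
rewrite (bsum_recl b1 (ub b)) (bsum_recl c1 (ub c)).
rewrite (bsum_recl b1 (fun n => ub b n.+1)) b_1.
rewrite (@eq_bsum _ b _ (fun=> 0)) => [|n]; last by rewrite b_2.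
rewrite (@eq_bsum _ c _ (fun n => u r * 1)) => [|n]; last by rewrite c_1 mulr1.
rewrite bsumZ ?bsum_cst0 ?bsum_cst1//; last first.
  by apply: (is_cvg_bterm (C := 1) c1) => n; rewrite normr1.
rewrite mul0r addr0 cE; congr (_ + _); field.
by rewrite addrK; apply/andP; split; lra.
Qed.

Lemma quadratic_pair_coincide (R : realType) (b c : R)
    (nu mu : probability (measurableTypeR R) R) : 1 < b -> 1 < c ->
  is_Renyi_Parry b nu -> is_Renyi_Parry c mu -> quadratic_pair b c ->
  measures_coincide nu mu.
Proof.
move=> b1 c1 nuP muP bc A mA; rewrite (renyi_parryE nuP)// (renyi_parryE muP)//.
congr (_%:E); congr (_^-1 * _).
- apply: (quadratic_pair_bsum (u := id) b1 bc) => // x /andP[x0 x1].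
  by rewrite ger0_norm.
- apply: quadratic_pair_bsum => //.
    by apply/eqP; rewrite eq_le len_ge0 len_le.
  move=> x /andP[x0 x1]; rewrite ger0_norm ?len_ge0//.
  exact: le_trans (len_le mA x0) x1.
Qed.

(** * Pisot numbers of degree 2 *)

(** The denominator divides the square of the numerator, to which it is coprime. *)
Lemma Qint_quadratic_root (u : rat) (s t : int) :
  u ^+ 2 - s%:~R * u + t%:~R = 0 -> u \is a Num.int.
Proof.
move=> uE; rewrite Qint_def.
have d0 : (denq u)%:~R != 0 :> rat by rewrite intr_eq0 denq_neq0.
have : numq u ^+ 2 = denq u * (s * numq u - t * denq u).
  apply/eqP; rewrite -(eqr_int rat) !(rmorphXn, rmorphM, rmorphB)/=.
  have nE : (numq u)%:~R = u * (denq u)%:~R by rewrite numqE.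
  rewrite nE -subr_eq0; apply/eqP.
  transitivity ((u ^+ 2 - s%:~R * u + t%:~R) * (denq u)%:~R ^+ 2 : rat).
    by ring.
  by rewrite uE mul0r.
move=> /(congr1 absz); rewrite abszX abszM => nd.
have : (`|denq u| %| `|numq u| ^ 2)%N by rewrite nd dvdn_mulr.
have : coprime `|denq u| (`|numq u| ^ 2).
  by rewrite coprime_sym coprimeXl// coprime_num_den.
rewrite /coprime => /[swap] /gcdn_idPl -> /eqP d1.
by rewrite -(gez0_abs (denq_ge0 u)) d1.
Qed.

Definition quad {A : nzRingType} (s t : A) : {poly A} :=
  'X^2 - s%:P * 'X + t%:P.

Lemma size_quad (A : nzRingType) (s t : A) : size (quad s t) = 3%N.
Proof.
rewrite /quad -addrA size_polyDl ?size_polyXn//.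
apply: leq_ltn_trans (size_polyD _ _) _; rewrite gtn_max size_polyN.
apply/andP; split; last by apply: leq_ltn_trans (size_polyC_leq1 _) _.
by rewrite mul_polyC; apply: leq_ltn_trans (size_scale_leq _ _) _; rewrite size_polyX.
Qed.

Lemma quad_monic (A : nzRingType) (s t : A) : quad s t \is monic.
Proof.
rewrite monicE /lead_coef size_quad /quad !(coefD, coefN, coefCM) coefXn coefX.
by rewrite coefC mulr0 subr0 addr0.
Qed.

Lemma horner_map_quad (A : nzRingType) (B : comNzRingType)
    (f : {rmorphism A -> B}) (s t : A) (x : B) :
  (map_poly f (quad s t)).[x] = x ^+ 2 - f s * x + f t.
Proof.
rewrite /quad !(rmorphD, rmorphN, rmorphM, rmorphXn)/= map_polyX !map_polyC/=.
by rewrite !hornerE.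
Qed.

Section quadratic_irrational.
Variables (R : realType) (x y : R) (s t : int).
Hypothesis xint : x \isn't a Num.int.
Hypothesis xy_add : x + y = s%:~R.
Hypothesis xy_mul : x * y = t%:~R.

Let P : {poly rat} := quad s%:~R t%:~R.

(** In degree 2 it suffices to exclude rational roots. Such a root would be an integer equal to [x]
    or [y], and an integer [y] would make x = s - y an integer. *)
Lemma quad_irreducible : irreducible_poly P.
Proof.
apply: cubic_irreducible; first by rewrite size_quad.
move=> u; apply/negP => /rootP; rewrite /P /quad !hornerE => uE.
have uint := Qint_quadratic_root uE.
have /(congr1 (ratr : rat -> R)) := uE.
rewrite !(rmorphD, rmorphN, rmorphM, rmorphXn)/= !ratr_int rmorph0.
rewrite -xy_add -xy_mul => xyE.
have : (ratr u - x) * (ratr u - y) == 0 :> R.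
  by rewrite -xyE; apply/eqP; ring.
have ruint : (ratr u : R) \is a Num.int.
  by move/intrP: uint => [m ->]; rewrite ratr_int intr_int.
rewrite mulf_eq0 !subr_eq0 => /orP[]/eqP uxy; move: ruint; rewrite uxy.
  exact/negP.
move=> yint; case/negP: xint.
have -> : x = s%:~R - y by rewrite -xy_add addrK.
by rewrite rpredB ?intr_int.
Qed.

(** If [q] vanishes at [x], so does its gcd with [P]; the gcd is then not constant, and
    irreducibility makes it associate to [P]. *)
Lemma quad_is_minpoly : is_minpoly x P.
Proof.
split=> [|q]; first exact: quad_monic.
have rootP : root (map_poly (ratr : rat -> R) P) x.
  apply/rootP; rewrite horner_map_quad /= !ratr_int -xy_add -xy_mul; ring.
apply/idP/idP => [qx|/dvdpP[r ->]]; last first.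
  by rewrite rmorphM rootM rootP orbT.
have g1 : size (gcdp P q) != 1%N.
  have gx : root (gcdp (map_poly ratr P) (map_poly (ratr : rat -> R) q)) x.
    by rewrite root_gcd rootP.
  rewrite -gcdp_map in gx; apply: contraL gx => /size_poly1P[c c0 ->].
  by rewrite map_polyC rootC fmorph_eq0.
have /eqp_dvdl <- := quad_irreducible.2 _ g1 (dvdp_gcdl P q).
exact: dvdp_gcdr.
Qed.

Lemma quad_has_degree : has_degree x 2.
Proof. by exists P; [exact: quad_is_minpoly|rewrite size_quad]. Qed.

Lemma quad_is_Pisot : 1 < x -> `|y| < 1 -> is_Pisot x.
Proof.
move=> x1 y1; split => //.
  exists (quad s t); first exact: quad_monic.
  by apply/rootP; rewrite horner_map_quad /= -xy_add -xy_mul; ring.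
exists P => [|z /rootP]; first exact: quad_is_minpoly.
rewrite horner_map_quad /= !ratr_int => zE zx.
have sC : s%:~R = x%:C%C + y%:C%C :> R[i] by rewrite -rmorphD xy_add rmorph_int.
have tC : t%:~R = x%:C%C * y%:C%C :> R[i] by rewrite -rmorphM xy_mul rmorph_int.
have : (z - x%:C%C) * (z - y%:C%C) == 0.
  by rewrite -zE sC tC; apply/eqP; ring.
rewrite mulf_eq0 subr_eq0 (negbTE zx) subr_eq0 => /eqP ->.
by rewrite normc_def /= expr0n addr0 sqrtr_sqr ltcR.
Qed.

End quadratic_irrational.

Lemma quadratic_pair_Pisot (R : realType) (b c : R) : 1 < b -> 1 < c ->
  b \isn't a Num.int -> c \isn't a Num.int -> quadratic_pair b c ->
  (is_Pisot b /\ has_degree b 2) /\ (is_Pisot c /\ has_degree c 2).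
Proof.
move=> b1 c1 bint cint /(quadratic_pair_root b1)[p [q [/andP[r0 r1] bp cE]]].
(* The conjugates are q - b in ]-1, 0[ for [b] and 1 + q - b in ]0, 1[ for [c]. *)
have bD : b + (q%:R - b) = (q : int)%:~R by rewrite -pmulrn; ring.
have bM : b * (q%:R - b) = (- (p : int))%:~R.
  by rewrite rmorphN/= -pmulrn -bp; ring.
have cD : c + (1 + q%:R - b) = (q.+2 : int)%:~R.
  by rewrite cE -pmulrn -!natr1; ring.
have cM : c * (1 + q%:R - b) = ((q.+1 : int) - (p : int))%:~R.
  by rewrite cE rmorphB/= -!pmulrn -natr1 -bp; ring.
split; split.
- by apply: (quad_is_Pisot bint bD bM) => //; rewrite ltr_norml; lra.
- exact: quad_has_degree bint bD bM.
- by apply: (quad_is_Pisot cint cD cM) => //; rewrite ltr_norml; lra.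
- exact: quad_has_degree cint cD cM.
Qed.

(** [quadratic_pair] puts the smaller base first; as the two bases come in no order, both orders
    appear, and the second reduces to the first by symmetry. *)
Theorem theorem1p1 (R : realType) (beta1 beta2 : R)
    (beta1_gt1 : 1 < beta1) (beta2_gt1 : 1 < beta2)
    (beta1_nint : beta1 \isn't a Num.int) (beta2_nint : beta2 \isn't a Num.int)
    (beta12 : beta1 != beta2)
    (nu1 nu2 : probability (measurableTypeR R) R)
    (nu1P : is_Renyi_Parry beta1 nu1) (nu2P : is_Renyi_Parry beta2 nu2) :
  (measures_coincide nu1 nu2 <->
     quadratic_pair beta1 beta2 \/ quadratic_pair beta2 beta1) /\
  (measures_coincide nu1 nu2 ->
     (is_Pisot beta1 /\ has_degree beta1 2) /\
     (is_Pisot beta2 /\ has_degree beta2 2)).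
Proof.
have qp := coincide_quadratic_pair beta1_gt1 beta2_gt1 beta1_nint beta2_nint
  beta12 nu1P nu2P.
split; [split => [//|[b12|b21]]|move=> /qp[b12|b21]].
- exact: quadratic_pair_coincide beta1_gt1 beta2_gt1 nu1P nu2P b12.
- move=> A mA; apply/esym.
  exact: quadratic_pair_coincide beta2_gt1 beta1_gt1 nu2P nu1P b21 _ mA.
- exact: quadratic_pair_Pisot.
- by apply/and_comm; exact: quadratic_pair_Pisot.
Qed.
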